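(* Let $(\mathcal A,\phi,\phi_2)$ with $\mathcal A=\mathbb C[x]$ be the second order probability space of the (second order) semi-circular operator $x$ and let $a=x^2$. Then for all integers $p,q\ge 1$ the second order cumulants of $a$ are \[ \kappa_{p,q}(a,\dots,a)=\sum_{k\ge 1}k\binom{p}{k}\binom{q}{k}. \]
   Context: The space: $\mathcal A=\mathbb C[x]$; $\phi:\mathcal A\to\mathbb C$ is linear with $\phi(1)=1$, $\phi(x^{2k-1})=0$, $\phi(x^{2k})=\frac1{k+1}\binom{2k}{k}$ for $k\ge1$; $\phi_2:\mathcal A\times\mathcal A\to\mathbb C$ is bilinear with $\phi_2(x^m,x^n)=0$ if $m=0$ or $n=0$ or $m+n$ is odd, and, for $m,n\ge 1$ with $m+n$ even, $\phi_2(x^m,x^n)=\sum_{k\ge1}k\binom{m}{(m-k)/2}\binom{n}{(n-k)/2}$, where a binomial coefficient is $0$ if its lower entry is not a non-negative integer. Permutations. $[n]=\{1,\dots,n\}$; $\#(\pi)$ is the number of cycles of $\pi$. $\gamma_n=(1,2,\dots,n)$, $\gamma_{p,q}=(1,\dots,p)(p+1,\dots,p+q)$. $NC(n)$ is the set of non-crossing partitions of $[n]$, identified with the permutations whose cycles are the blocks listed in increasing order. $NC(p)\times NC(q)$ is the set of $\pi=\pi_1\times\pi_2\in S_{p+q}$ with $\pi_1$ a non-crossing permutation of $[p]$ and $\pi_2$ one of $\{p+1,\dots,p+q\}$. $S_{NC}(p,q)$ is the set of $\pi\in S_{p+q}$ such that some cycle of $\pi$ meets both $[p]$ and $\{p+1,\dots,p+q\}$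 and $\#(\pi)+\#(\pi^{-1}\gamma_{p,q})+\#(\gamma_{p,q})=p+q+2$. Partitioned permutations. A partitioned permutation of $[n]$ is a pair $(\mathcal V,\pi)$ with $\mathcal V$ a partition of $[n]$, $\pi\in S_n$ and every cycle of $\pi$ contained in a block of $\mathcal V$. $0_\pi$ is the partition into cycles of $\pi$; $\pi\in S_{NC}(p,q)$ is identified with $(0_\pi,\pi)$. $\mathcal{PS}_{NC}(p,q)'$ is the set of $(\mathcal V,\pi)$ with $\pi=\pi_1\times\pi_2\in NC(p)\times NC(q)$ such that every block of $\mathcal V$ except one contains exactly one cycle of $\pi$, and the exceptional block contains exactly two, one of $\pi_1$ and one of $\pi_2$. $\mathcal{PS}_{NC}(p,q)=S_{NC}(p,q)\cup\mathcal{PS}_{NC}(p,q)'$. Cumulants. The multilinear functionals $\kappa_n$ are defined recursively by $\phi(a_1\cdots a_n)=\sum_{\pi\in NC(n)}\kappa_\pi(a_1,\dots,a_n)$, and the $(p+q)$-linear functionals $\kappa_{p,q}$ recursively by $\phi_2(a_1\cdots a_p,a_{p+1}\cdots a_{p+q})=\sum_{(\mathcal V,\pi)\in\mathcal{PS}_{NC}(p,q)}\kappa_{(\mathcal V,\pi)}(a_1,\dots,a_{p+q})$. Here $\kappa_\pi=\prod_c\kappa_c$ over the cycles $c=(i_1,\dots,i_m)$ of $\pi$, with $\kappa_c(a_1,\dots)=\kappa_m(a_{i_1},\dots,a_{i_m})$, and $\kappa_{(\mathcal V,\pi)}=\prod_{V\in\mathcal V}\kappa_V$, where $\kappa_V=\kappa_c$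 if $V$ contains one cycle $c$ of $\pi$, and $\kappa_V=\kappa_{m,l}(a_{i_1},\dots,a_{i_m},a_{j_1},\dots,a_{j_l})$ if $V$ contains two cycles, $(i_1,\dots,i_m)$ in $[p]$ and $(j_1,\dots,j_l)$ in $\{p+1,\dots,p+q\}$. In $\kappa_{p,q}(a,\dots,a)$ all $p+q$ arguments equal $a$. *)

(* Defs.v *)
From HB Require Import structures.
From mathcomp Require Import all_boot all_order all_algebra all_fingroup.
From mathcomp Require Import reals complex.

Set Implicit Arguments.
Unset Strict Implicit.
Unset Printing Implicit Defensive.

Import GRing.Theory.
Local Open Scope ring_scope.

(* [n] is 'I_n (so indices start at 0); in 'I_(p + q), the first p indices are
   the range of lshift and the last q ones the range of rshift. *)

Section Permutations.

(* #(pi) *)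
Definition ncycles n (pi : 'S_n) : nat := #|porbits pi|.

(* gamma_n, i |-> i + 1 modulo n. *)
Definition gamma n : 'S_n := perm (@ordS_inj n).

Definition prod_fun p q (u : 'S_p) (v : 'S_q) (i : 'I_(p + q)) : 'I_(p + q) :=
  match split i with inl j => lshift q (u j) | inr j => rshift p (v j) end.

Lemma prod_fun_inj p q (u : 'S_p) (v : 'S_q) : injective (prod_fun u v).
Proof.
move=> i j; rewrite /prod_fun -{2}(splitK i) -{2}(splitK j).
case: (split i) => a; case: (split j) => b /=.
- by move/lshift_inj/perm_inj ->.
- by move/eqP; rewrite eq_lrshift.
- by move/eqP; rewrite eq_rlshift.
- by move/rshift_inj/perm_inj ->.
Qed.

(* u x v, acting as u on the first p indices and as v on the last q ones. *)
Definition perm_prod p q (u : 'S_p) (v : 'S_q) : 'S_(p + q) :=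
  perm (@prod_fun_inj p q u v).

Definition gamma2 p q : 'S_(p + q) := perm_prod (gamma p) (gamma q).

(* Cycles are represented by their smallest elements. *)
Definition leader n (pi : 'S_n) (i : 'I_n) : bool :=
  [forall j in porbit pi i, (i <= j)%N].

Definition noncrossing n (P : {set {set 'I_n}}) : bool :=
  [forall B in P, forall B' in P, (B != B') ==>
    ~~ [exists a in B, exists b in B', exists c in B, exists d in B',
         [&& a < b, b < c & c < d]%N]].

(* For a leader i, fingraph.orbit pi i is the cycle (i, pi i, pi (pi i), ...). *)
Definition increasing_cycles n (pi : 'S_n) : bool :=
  [forall i, leader pi i ==> sorted ltn [seq val j | j <- fingraph.orbit pi i]].

(* NC(n), as a set of permutations. *)
Definition NC n : {set 'S_n} :=
  [set pi | increasing_cycles pi && noncrossing (porbits pi)].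

Definition NCprod p q : {set 'S_(p + q)} :=
  [set perm_prod uv.1 uv.2 | uv in setX (NC p) (NC q)].

(* Since (s * t)%g is "s, then t", gamma2 p q * pi^-1 is the permutation
   i |-> pi^-1 (gamma_{p,q} i). *)
Definition SNC p q : {set 'S_(p + q)} :=
  [set pi | [exists c in porbits pi,
               [exists i : 'I_p, lshift q i \in c] &&
               [exists j : 'I_q, rshift p j \in c]] &&
            (ncycles pi + ncycles (gamma2 p q * pi^-1)%g + ncycles (gamma2 p q)
               == p + q + 2)%N].

End Permutations.

Section PartitionedPermutations.

Definition is_partitioned_perm n (Vpi : {set {set 'I_n}} * 'S_n) : bool :=
  partition Vpi.1 [set: 'I_n] &&
  [forall c in porbits Vpi.2, exists B in Vpi.1, c \subset B].

Definition cycles_in n (pi : 'S_n) (B : {set 'I_n}) : {set {set 'I_n}} :=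
  [set c in porbits pi | c \subset B].

Definition left_part p q : {set 'I_(p + q)} := [set lshift q i | i : 'I_p].
Definition right_part p q : {set 'I_(p + q)} := [set rshift p j | j : 'I_q].

Definition PSNC' p q : {set {set {set 'I_(p + q)}} * 'S_(p + q)} :=
  [set Vpi | [&& is_partitioned_perm Vpi, Vpi.2 \in NCprod p q &
     [exists B in Vpi.1,
       [exists c, exists d, [&& cycles_in Vpi.2 B == [set c; d],
          c \subset left_part p q & d \subset right_part p q]] &&
       [forall B' in Vpi.1, (B' != B) ==> (#|cycles_in Vpi.2 B'| == 1%N)]]]].

Definition PSNC p q : {set {set {set 'I_(p + q)}} * 'S_(p + q)} :=
  [set (porbits pi, pi) | pi in SNC p q] :|: PSNC' p q.

End PartitionedPermutations.

(* A family of n-ary functionals (n >= 1) on T is given by a function of the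
   list of its arguments, and a family of (p + q)-ary functionals (p, q >= 1)
   by a function of the list of the first p and the list of the last q
   arguments. *)
Section Cumulants.

Variables (A : pzRingType) (C : comPzRingType).
Variables (phi : A -> C) (phi2 : A -> A -> C).
Variables (kappa : seq A -> C) (kappa2 : seq A -> seq A -> C).

(* The arguments along the cycle of i, listed from i on. *)
Definition cycle_args n (a : 'I_n -> A) (pi : 'S_n) (i : 'I_n) : seq A :=
  [seq a j | j <- fingraph.orbit pi i].

Definition kappa_perm n (a : 'I_n -> A) (pi : 'S_n) : C :=
  \prod_(i | leader pi i) kappa (cycle_args a pi i).

(* enum B is increasing, so that, if B contains one cycle in the first p
   indices and one in the last q ones, the former comes first. *)
Definition kappa_block n (a : 'I_n -> A) (pi : 'S_n) (B : {set 'I_n}) : C :=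
  match [seq i <- enum B | leader pi i] with
  | [:: i] => kappa (cycle_args a pi i)
  | [:: i; j] => kappa2 (cycle_args a pi i) (cycle_args a pi j)
  | _ => 0
  end.

Definition kappa_partitioned n (a : 'I_n -> A)
    (Vpi : {set {set 'I_n}} * 'S_n) : C :=
  \prod_(B in Vpi.1) kappa_block a Vpi.2 B.

(* By induction on the number of arguments, the following relations determine
   kappa on nonempty lists and kappa2 on pairs of nonempty lists (and these are
   multilinear when phi is linear and phi2 is bilinear); existence is
   free_cumulants_exist and second_order_cumulants_exist below. *)
Definition free_cumulants : Prop :=
  forall s : seq A, (0 < size s)%N ->
    phi (\prod_(x <- s) x) =
    \sum_(pi in NC (size s)) kappa_perm (fun i => nth 0 s i) pi.

Definition second_order_cumulants : Prop :=
  forall s t : seq A, (0 < size s)%N -> (0 < size t)%N ->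
    phi2 (\prod_(x <- s) x) (\prod_(x <- t) x) =
    \sum_(Vpi in PSNC (size s) (size t))
      kappa_partitioned (fun i => nth 0 (s ++ t) i) Vpi.

End Cumulants.

Section SemiCircular.

Variable R : realType.
Local Notation C := R[i].

Definition sc_moment (n : nat) : C :=
  if odd n then 0 else ('C(n, n./2))%:R / (n./2.+1)%:R.

(* binom(m, (m - k) / 2), zero if (m - k) / 2 is not a natural number. *)
Definition half_binom (m k : nat) : nat :=
  if (k <= m)%N && ~~ odd (m - k) then 'C(m, (m - k)./2) else 0%N.

(* The sum over k >= 1 stops at m, as half_binom m k = 0 for k > m. *)
Definition sc_fluctuation (m n : nat) : C :=
  if [|| m == 0%N, n == 0%N | odd (m + n)] then 0
  else (\sum_(1 <= k < m.+1) k * half_binom m k * half_binom n k)%N%:R.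

Definition sc_phi (f : {poly C}) : C := \sum_(i < size f) f`_i * sc_moment i.

Definition sc_phi2 (f g : {poly C}) : C :=
  \sum_(i < size f) \sum_(j < size g) f`_i * g`_j * sc_fluctuation i j.

Lemma sc_phiE n (f : {poly C}) : (size f <= n)%N ->
  sc_phi f = \sum_(i < n) f`_i * sc_moment i.
Proof.
move=> le; rewrite /sc_phi (big_ord_widen n (fun i => f`_i * sc_moment i)) //.
rewrite big_mkcond; apply: eq_bigr => i _; case: ltnP => // fi.
by rewrite nth_default // mul0r.
Qed.

Lemma sc_phi_is_linear : linear_for *%R sc_phi.
Proof.
move=> c f g; pose n := maxn (size (c *: f + g)) (maxn (size f) (size g)).
rewrite !(@sc_phiE n) ?leq_max ?leqnn ?orbT // mulr_sumr -big_split /=.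
by apply: eq_bigr => i _; rewrite coefD coefZ mulrDl mulrA.
Qed.

Lemma sc_phi2E m n (f g : {poly C}) : (size f <= m)%N -> (size g <= n)%N ->
  sc_phi2 f g = \sum_(i < m) \sum_(j < n) f`_i * g`_j * sc_fluctuation i j.
Proof.
move=> lf lg; rewrite /sc_phi2.
rewrite (big_ord_widen m
  (fun i => \sum_(j < size g) f`_i * g`_j * sc_fluctuation i j)) //.
rewrite big_mkcond; apply: eq_bigr => i _; case: ltnP => fi; last first.
  by rewrite big1 // => j _; rewrite nth_default // !mul0r.
rewrite (big_ord_widen n (fun j => f`_i * g`_j * sc_fluctuation i j)) //.
rewrite big_mkcond; apply: eq_bigr => j _; case: ltnP => // gj.
by rewrite [g`_j]nth_default // mulr0 mul0r.
Qed.

Lemma sc_phi2_is_linear_l g : linear_for *%R (sc_phi2^~ g).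
Proof.
move=> c f h; pose n := maxn (size (c *: f + h)) (maxn (size f) (size h)).
rewrite !(@sc_phi2E n (size g)) ?leq_max ?leqnn ?orbT // mulr_sumr -big_split /=.
apply: eq_bigr => i _; rewrite mulr_sumr -big_split /=.
by apply: eq_bigr => j _; rewrite coefD coefZ !mulrDl !mulrA.
Qed.

Lemma sc_phi2_is_linear_r f : linear_for *%R (sc_phi2 f).
Proof.
move=> c g h; pose n := maxn (size (c *: g + h)) (maxn (size g) (size h)).
rewrite !(@sc_phi2E (size f) n) ?leq_max ?leqnn ?orbT // mulr_sumr -big_split /=.
apply: eq_bigr => i _; rewrite mulr_sumr -big_split /=.
apply: eq_bigr => j _; rewrite coefD coefZ mulrDr mulrDl !mulrA.
by rewrite [f`_i * c]mulrC.
Qed.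

Lemma sc_phiXn n : sc_phi 'X^n = sc_moment n.
Proof.
rewrite /sc_phi size_polyXn (bigD1 ord_max) //= coefXn eqxx mul1r big1 ?addr0 //.
by move=> i; rewrite -val_eqE coefXn => /= /negPf ->; rewrite mul0r.
Qed.

Lemma sc_phi2Xn m n : sc_phi2 'X^m 'X^n = sc_fluctuation m n.
Proof.
rewrite /sc_phi2 !size_polyXn (bigD1 ord_max) //= [X in _ + X]big1 ?addr0.
  rewrite (bigD1 ord_max) //= !coefXn !eqxx !mul1r big1 ?addr0 //.
  by move=> j; rewrite -val_eqE !coefXn => /= /negPf ->; rewrite mulr0 mul0r.
move=> i; rewrite -val_eqE => /= /negPf ni; rewrite big1 // => j _.
by rewrite coefXn ni !mul0r.
Qed.

End SemiCircular.

Section OrbitFacts.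
Local Notation orb := fingraph.orbit.

Lemma mem_orb n (pi : 'S_n) i j : (j \in orb pi i) = (j \in porbit pi i).
Proof.
rewrite -fconnect_orbit; apply/idP/porbitP => [|[k ->]].
  by move/iter_findex <-; exists (findex pi i j); rewrite permX.
by rewrite permX fconnect_iter.
Qed.

Lemma size_orb n (pi : 'S_n) i : size (orb pi i) = #|porbit pi i|.
Proof.
rewrite -(card_uniqP (orbit_uniq _ _)).
by apply: eq_card => j; rewrite -mem_orb.
Qed.

Lemma leader_uniq n (pi : 'S_n) i j :
  leader pi i -> leader pi j -> porbit pi i = porbit pi j -> i = j.
Proof.
move=> /forall_inP li /forall_inP lj e; apply: val_inj => /=.
apply/eqP; rewrite eqn_leq li ?lj //; first by rewrite -e porbit_id.
by rewrite e porbit_id.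
Qed.

Lemma iter_gamma n (i : 'I_n.+1) : iter i (gamma n.+1) ord0 = i.
Proof.
suff H k : (k < n.+1)%N -> iter k (gamma n.+1) ord0 = k :> nat.
  by apply: val_inj; rewrite /= H.
elim: k => //= k IH lt; rewrite permE /= IH; last by apply: ltnW.
by rewrite modn_small.
Qed.

Lemma porbit_gamma n (i : 'I_n.+1) : porbit (gamma n.+1) i = setT.
Proof.
have <- : porbit (gamma n.+1) ord0 = porbit (gamma n.+1) i.
  apply/eqP; rewrite eq_sym eq_porbit_mem; apply/porbitP; exists (nat_of_ord i).
  by rewrite permX iter_gamma.
apply/setP=> j; rewrite inE; apply/porbitP; exists (nat_of_ord j).
by rewrite permX iter_gamma.
Qed.

Lemma orb_gamma n : orb (gamma n.+1) ord0 = enum 'I_n.+1.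
Proof.
apply: (@eq_from_nth _ ord0).
  by rewrite size_orb porbit_gamma cardsT card_ord size_enum_ord.
move=> k; rewrite size_orb porbit_gamma cardsT card_ord => lt.
rewrite /orb nth_traject; last first.
  by rewrite -size_orbit size_orb porbit_gamma cardsT card_ord.
have /= -> := iter_gamma (Ordinal lt).
by apply: val_inj; rewrite /= nth_enum_ord.
Qed.

Lemma leader_gamma n (i : 'I_n.+1) : leader (gamma n.+1) i = (i == ord0).
Proof.
apply/forall_inP/eqP => [/(_ ord0)|-> //].
by rewrite porbit_gamma inE => /(_ isT); rewrite leqn0 => /eqP e; apply: val_inj.
Qed.

Lemma gamma_NC n : gamma n.+1 \in NC n.+1.
Proof.
rewrite inE; apply/andP; split.
  apply/forallP => i; apply/implyP; rewrite leader_gamma => /eqP ->.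
  by rewrite orb_gamma val_enum_ord iota_ltn_sorted.
apply/forall_inP => B /imsetP[i _ ->]; apply/forall_inP => B' /imsetP[j _ ->].
by rewrite !porbit_gamma eqxx.
Qed.

Lemma NC_full n (pi : 'S_n) i :
  pi \in NC n -> (n <= size (orb pi i))%N -> pi = gamma n.
Proof.
case: n pi i => [|n] pi i; first by case: i.
rewrite inE size_orb => /andP[/forallP inc _] full.
have oT : porbit pi i = setT.
  by apply/eqP; rewrite eqEcard subsetT cardsT card_ord.
have o0 : porbit pi ord0 = setT.
  by rewrite -oT; apply/eqP; rewrite eq_porbit_mem oT.
have l0 : leader pi ord0 by apply/forall_inP.
have {}inc := implyP (inc ord0) l0.
have e : orb pi ord0 = enum 'I_n.+1.
  apply: (inj_map val_inj); rewrite val_enum_ord.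
  apply: (irr_sorted_eq ltn_trans ltnn inc (iota_ltn_sorted _ _)) => k.
  rewrite mem_iota /= add0n; apply/idP/idP => [/mapP[j _ ->]|lt].
    exact: ltn_ord.
  apply/mapP; exists (Ordinal lt); last by [].
  by rewrite mem_orb o0 inE.
have ordE : fingraph.order pi ord0 = n.+1 by rewrite -size_orbit e size_enum_ord.
have it k : (k < n.+1)%N -> iter k pi ord0 = k :> nat.
  move=> lt; have := nth_traject pi lt ord0.
  have -> : traject pi ord0 n.+1 = orb pi ord0 by rewrite /orb ordE.
  by rewrite e => <-; rewrite nth_enum_ord.
have it' (j : 'I_n.+1) : iter j pi ord0 = j by apply: val_inj; rewrite /= it.
apply/permP => j; apply: val_inj; rewrite -(it' j) -iterS permE /= it //.
have := ltn_ord j; rewrite leq_eqVlt => /orP[/eqP e1|lt].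
  rewrite e1 modnn -iterS e1.
  by have := iter_order (@perm_inj _ pi) ord0; rewrite ordE => ->.
by rewrite -iterS it // modn_small.
Qed.

End OrbitFacts.

Section Existence1.
Variables (A : pzRingType) (C : comPzRingType).
Variables (phi : A -> C).

Fixpoint cumulant_rec fuel (s : seq A) : C :=
  if fuel is m.+1 then
    phi (\prod_(x <- s) x) -
    \sum_(pi in NC (size s) | pi != gamma (size s))
       kappa_perm (cumulant_rec m) (fun i => nth 0 s i) pi
  else 0.

Lemma size_cycle_args n (a : 'I_n -> A) pi i :
  size (cycle_args a pi i) = #|porbit pi i|.
Proof. by rewrite size_map size_orb. Qed.

Lemma cycle_args_gt0 n (a : 'I_n -> A) pi i : (0 < size (cycle_args a pi i))%N.
Proof. by rewrite size_cycle_args; apply/card_gt0P; exists i; apply: porbit_id. Qed.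

Lemma size_cycle_NC (a : nat -> A) n (pi : 'S_n) i :
  pi \in NC n -> pi != gamma n ->
  (size (cycle_args (fun i : 'I_n => a i) pi i) < n)%N.
Proof.
move=> piNC pig; rewrite ltnNge; apply: contra pig => full.
by apply/eqP/(@NC_full _ _ i) => //; rewrite size_orb -(size_cycle_args a).
Qed.

Lemma cumulant_rec_stable m m' s : (0 < size s)%N ->
  (size s <= m)%N -> (size s <= m')%N -> cumulant_rec m s = cumulant_rec m' s.
Proof.
elim: m m' s => [|m IH] [|m'] s gt; rewrite ?leqn0; try by case: (size s) gt.
move=> le le' /=; congr (_ - _); apply: eq_bigr => pi /andP[piNC pig].
apply: eq_bigr => i _.
have lt := size_cycle_NC (nth 0 s) i piNC pig.
by apply: IH; rewrite ?cycle_args_gt0 // -ltnS; apply: leq_trans lt _.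
Qed.

Lemma kappa_perm_gamma (kappa : seq A -> C) n s : size s = n -> (0 < n)%N ->
  kappa_perm kappa (fun i : 'I_n => nth 0 s i) (gamma n) = kappa s.
Proof.
case: n => // n sz _; rewrite /kappa_perm (eq_bigl _ _ (@leader_gamma n)) big_pred1_eq.
rewrite /cycle_args orb_gamma (map_comp (nth 0 s) val) val_enum_ord -sz.
by rewrite map_nth_iota0 // take_size.
Qed.

Lemma free_cumulants_exist : exists kappa, free_cumulants phi kappa.
Proof.
exists (fun s => cumulant_rec (size s) s) => s gt.
rewrite (bigD1 (gamma (size s))) /=; last by rewrite -(prednK gt) gamma_NC.
rewrite kappa_perm_gamma //.
have -> : cumulant_rec (size s) s = cumulant_rec (size s).-1.+1 s by rewrite prednK.
rewrite /= -[LHS](subrK (\sum_(pi in NC (size s) | pi != gamma (size s))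
  kappa_perm (cumulant_rec (size s).-1) (fun i => nth 0 s i) pi)).
congr (_ + _); apply: eq_bigr => pi /andP[piNC pig].
apply: eq_bigr => i _.
have := size_cycle_NC (nth 0 s) i piNC pig.
set w := cycle_args _ _ _ => lt.
by apply: cumulant_rec_stable; rewrite ?cycle_args_gt0 // -ltnS prednK.
Qed.
End Existence1.

Section ProdFacts.
Local Notation orb := fingraph.orbit.
Variables (p q : nat).
Implicit Types (u : 'S_p) (v : 'S_q).

Lemma perm_prodl u v i : perm_prod u v (lshift q i) = lshift q (u i).
Proof. by rewrite permE /prod_fun (unsplitK (inl i)). Qed.

Lemma perm_prodr u v j : perm_prod u v (rshift p j) = rshift p (v j).
Proof. by rewrite permE /prod_fun (unsplitK (inr j)). Qed.

Lemma iter_prodl u v k i : iter k (perm_prod u v) (lshift q i) = lshift q (iter k u i).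
Proof. by elim: k => //= k ->; rewrite perm_prodl. Qed.

Lemma iter_prodr u v k j : iter k (perm_prod u v) (rshift p j) = rshift p (iter k v j).
Proof. by elim: k => //= k ->; rewrite perm_prodr. Qed.

Lemma porbit_prodl u v i :
  porbit (perm_prod u v) (lshift q i) = [set lshift q j | j in porbit u i].
Proof.
apply/setP=> x; apply/porbitP/imsetP => [[k ->]|[_ /porbitP[k ->] ->]].
  by exists (iter k u i); rewrite ?permX ?iter_prodl // -permX mem_porbit.
by exists k; rewrite !permX iter_prodl.
Qed.

Lemma porbit_prodr u v i :
  porbit (perm_prod u v) (rshift p i) = [set rshift p j | j in porbit v i].
Proof.
apply/setP=> x; apply/porbitP/imsetP => [[k ->]|[_ /porbitP[k ->] ->]].
  by exists (iter k v i); rewrite ?permX ?iter_prodr // -permX mem_porbit.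
by exists k; rewrite !permX iter_prodr.
Qed.

Lemma orb_prodl u v i : orb (perm_prod u v) (lshift q i) = map (lshift q) (orb u i).
Proof.
rewrite /orb.
have -> : fingraph.order (perm_prod u v) (lshift q i) = fingraph.order u i.
  rewrite -2!size_orbit 2!size_orb porbit_prodl card_imset //; exact: lshift_inj.
by move: (fingraph.order u i) => m; elim: m i => //= n IH k; rewrite perm_prodl IH.
Qed.

Lemma orb_prodr u v i : orb (perm_prod u v) (rshift p i) = map (@rshift p q) (orb v i).
Proof.
rewrite /orb.
have -> : fingraph.order (perm_prod u v) (rshift p i) = fingraph.order v i.
  rewrite -2!size_orbit 2!size_orb porbit_prodr card_imset //; exact: rshift_inj.
by move: (fingraph.order v i) => m; elim: m i => //= n IH k; rewrite perm_prodr IH.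
Qed.

Lemma leader_prodl u v i : leader (perm_prod u v) (lshift q i) = leader u i.
Proof.
rewrite /leader porbit_prodl; apply/forall_inP/forall_inP => H j.
  by move=> ji; apply: (H (lshift q j)); apply: imset_f.
by case/imsetP=> k /H ik ->.
Qed.

Lemma leader_prodr u v i : leader (perm_prod u v) (rshift p i) = leader v i.
Proof.
rewrite /leader porbit_prodr; apply/forall_inP/forall_inP => H j.
  by move=> ji; have := H (rshift p j) (imset_f _ ji); rewrite /= leq_add2l.
by case/imsetP=> k /H ik ->; rewrite /= leq_add2l.
Qed.

Lemma enum_prod : enum 'I_(p + q) = map (lshift q) (enum 'I_p) ++ map (@rshift p q) (enum 'I_q).
Proof.
have lE : map val (map (lshift q) (enum 'I_p)) = iota 0 p.
  by rewrite -val_enum_ord -map_comp; apply: eq_map.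
have rE : map val (map (@rshift p q) (enum 'I_q)) = iota p q.
  rewrite -[in iota p q](addn0 p) iotaDl -val_enum_ord -(map_comp (addn p)) -map_comp; symmetry.
  exact: eq_map.
apply: (inj_map val_inj).
by rewrite map_cat lE rE val_enum_ord iotaD add0n.
Qed.

End ProdFacts.

Definition top_partitioned p q : {set {set 'I_(p + q)}} * 'S_(p + q) :=
  ([set setT], gamma2 p q).

Lemma leader_gamma_filter n : [seq i <- enum 'I_n.+1 | leader (gamma n.+1) i] = [:: ord0].
Proof.
rewrite (eq_filter (@leader_gamma n)) enum_ordSl /= filter_map.
by rewrite (eq_filter (a2 := pred0)) ?filter_pred0.
Qed.

Section Block.
Variables (A : pzRingType) (C : comPzRingType).
Lemma kappa_top (kappa : seq A -> C) kappa2 s t p q : size s = p -> size t = q -> (0 < p)%N -> (0 < q)%N ->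
  kappa_partitioned kappa kappa2 (fun i : 'I_(p + q) => nth 0 (s ++ t) i) (top_partitioned p q) = kappa2 s t.
Proof.
case: p q => [|p] // [|q] // sz tz _ _; rewrite /kappa_partitioned /= big_set1 /kappa_block.
have -> : [seq i <- enum [set: 'I_(p.+1 + q.+1)] | leader (gamma2 p.+1 q.+1) i]
    = [:: lshift q.+1 ord0; rshift p.+1 ord0].
  rewrite enum_setT -enumT enum_prod filter_cat (filter_map (lshift _)) (filter_map (@rshift _ _)).
  rewrite (eq_filter (a2 := leader (gamma p.+1))); last by move=> i; apply: leader_prodl.
  rewrite leader_gamma_filter (eq_filter (a2 := leader (gamma q.+1))) ?leader_gamma_filter //.
  by move=> i; apply: leader_prodr.
rewrite /cycle_args orb_prodl orb_prodr !orb_gamma.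
congr (kappa2 _ _); rewrite -map_comp.
  rewrite -[RHS]take_size -(map_nth_iota0 0 (leqnn _)) sz -val_enum_ord -[RHS]map_comp.
  by apply: eq_map => i /=; rewrite nth_cat sz ltn_ord.
rewrite -[RHS]take_size -(map_nth_iota0 0 (leqnn _)) tz -val_enum_ord -[RHS]map_comp.
by apply: eq_map => i /=; rewrite nth_cat sz ltnNge leq_addr /= addKn.
Qed.
End Block.

Lemma top_partitioned_PSNC p q : (0 < p)%N -> (0 < q)%N -> top_partitioned p q \in PSNC p q.
Proof.
case: p q => [|p] // [|q] // _ _; rewrite inE; apply/orP; right; rewrite inE /top_partitioned /=.
have cl : [set lshift q.+1 j | j in [set: 'I_p.+1]] \in porbits (gamma2 p.+1 q.+1).
  by rewrite -(porbit_gamma ord0) -(porbit_prodl _ (gamma q.+1)); apply: imset_f.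
have cr : [set rshift p.+1 j | j in [set: 'I_q.+1]] \in porbits (gamma2 p.+1 q.+1).
  by rewrite -(porbit_gamma ord0) -(porbit_prodr (gamma p.+1)); apply: imset_f.
apply/and3P; split.
- apply/andP; split=> /=.
    rewrite /partition /cover big_set1 eqxx /= trivIset1 inE eq_sym.
    by apply/set0Pn; exists ord0.
  by apply/forall_inP=> c _; apply/exists_inP; exists setT; rewrite ?inE.
- by apply/imsetP; exists (gamma p.+1, gamma q.+1); rewrite ?in_setX ?gamma_NC.
apply/exists_inP; exists setT; first by rewrite inE.
apply/andP; split; last by apply/forall_inP=> B; rewrite inE => ->.
apply/existsP; exists (left_part p.+1 q.+1).
apply/existsP; exists (right_part p.+1 q.+1).
rewrite !subxx !andbT; apply/eqP/setP=> c; rewrite !inE subsetT andbT.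
apply/imsetP/orP => [[x _ ->]|].
  rewrite -(splitK x); case: (split x) => i /=; [left|right].
    by rewrite porbit_prodl porbit_gamma; apply/eqP/setP => y; apply/imsetP/imsetP => -[j _ ->]; exists j.
  by rewrite porbit_prodr porbit_gamma; apply/eqP/setP => y; apply/imsetP/imsetP => -[j _ ->]; exists j.
case=> /eqP ->.
  exists (lshift _ ord0) => //.
  by rewrite porbit_prodl porbit_gamma; apply/setP => y; apply/imsetP/imsetP => -[j _ ->]; exists j.
exists (rshift _ ord0) => //.
by rewrite porbit_prodr porbit_gamma; apply/setP => y; apply/imsetP/imsetP => -[j _ ->]; exists j.
Qed.

Lemma PSNC_full p q (Vpi : {set {set 'I_(p + q)}} * 'S_(p + q)) B i j :
  (0 < p)%N -> (0 < q)%N ->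
  Vpi \in PSNC p q -> B \in Vpi.1 ->
  [seq i <- enum B | leader Vpi.2 i] = [:: i; j] ->
  (p + q <= #|porbit Vpi.2 i| + #|porbit Vpi.2 j|)%N -> Vpi = top_partitioned p q.
Proof.
move=> p0 q0 mem BV E full.
have ij : i != j.
  have : uniq [:: i; j] by rewrite -E filter_uniq // enum_uniq.
  by rewrite /= inE andbT.
have /andP[li iB] : leader Vpi.2 i && (i \in B).
  by rewrite -mem_enum -mem_filter E inE eqxx.
have /andP[lj jB] : leader Vpi.2 j && (j \in B).
  by rewrite -mem_enum -mem_filter E !inE eqxx orbT.
have nij : porbit Vpi.2 i != porbit Vpi.2 j.
  by apply: contra ij => /eqP e; apply/eqP; apply: leader_uniq e.
have := mem; rewrite inE => /orP[/imsetP[pi _ e]|].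
  move: nij iB jB BV; rewrite e /= => nij iB jB /imsetP[k _ eB].
  by move: nij iB jB; rewrite eB -!eq_porbit_mem => nij /eqP <- /eqP e'; rewrite e' eqxx in nij.
have dis : [disjoint porbit Vpi.2 i & porbit Vpi.2 j].
  apply/pred0P => k /=; apply/negP => /andP[].
  rewrite -!eq_porbit_mem => /eqP e /eqP e'; by rewrite -e -e' eqxx in nij.
have un : porbit Vpi.2 i :|: porbit Vpi.2 j = setT.
  apply/eqP; rewrite eqEcard subsetT cardsT card_ord /= cardsU.
  by move: dis; rewrite -setI_eq0 => /eqP ->; rewrite cards0 subn0.
case: Vpi mem BV E full li lj nij dis un => V pi /= mem BV E full li lj nij dis un.
rewrite inE /= => /and3P[/andP[/= pV /forall_inP sub] /imsetP[[u v]] /=].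
rewrite in_setX => /andP[/= uNC vNC] epi.
case/exists_inP => B' B'V /andP[/existsP[c /existsP[d /and3P[/eqP eB' cl dr]]] _].
have cin : c \in cycles_in pi B' by rewrite eB' !inE eqxx.
have din : d \in cycles_in pi B' by rewrite eB' !inE eqxx orbT.
move: cin din; rewrite !inE => /andP[/imsetP[k _ ec] cB] /andP[/imsetP[l _ ed] dB].
have two x : (porbit pi x == porbit pi i) || (porbit pi x == porbit pi j).
  have : x \in setT by [].
  by rewrite -un inE -!eq_porbit_mem.
have ncd : c != d.
  apply/eqP => e; have kc : k \in c by rewrite ec porbit_id.
  have /imsetP[a _ ea] := subsetP cl _ kc; rewrite e in kc.
  have /imsetP[b _ eb] := subsetP dr _ kc.
  by move: (eq_lrshift a b); rewrite -ea -eb eqxx.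
have cd : c :|: d = setT.
  move: (two k) (two l) ncd; rewrite -ec -ed.
  by case/orP=> /eqP -> /orP[] /eqP ->; rewrite ?eqxx // setUC.
have BT : B' = setT by apply/eqP; rewrite eqEsubset subsetT -cd subUset cB dB.
have eV : V = [set setT].
  have /and3P[/eqP cov /trivIsetP tr n0] := pV.
  apply/setP=> X; rewrite inE; apply/idP/eqP => [XV|->]; last by rewrite -BT.
  apply/eqP; apply: contraT => nX.
  have := tr _ _ XV B'V; rewrite BT => /(_ nX).
  rewrite -setI_eq0 setIT => /eqP e; by rewrite -e XV in n0.
have kl : exists a, k = lshift q a.
  have kc : k \in c by rewrite ec porbit_id.
  by have /imsetP[a _ ea] := subsetP cl _ kc; exists a.
have lr : exists b, l = rshift p b.
  have kc : l \in d by rewrite ed porbit_id.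
  by have /imsetP[a _ ea] := subsetP dr _ kc; exists a.
case: kl lr => a ea [b eb].
rewrite /top_partitioned eV epi /gamma2; congr (_, perm_prod _ _).
  apply: (@NC_full _ _ a) => //; rewrite size_orb.
  rewrite -[X in (X <= _)%N](card_ord p) -cardsT subset_leq_card //.
  apply/subsetP => x _; have : lshift q x \in setT by [].
  rewrite -cd ec ed ea eb epi porbit_prodl porbit_prodr inE.
  case/orP => /imsetP[y yin]; first by move/lshift_inj => ->.
  by move/eqP; rewrite eq_lrshift.
apply: (@NC_full _ _ b) => //; rewrite size_orb.
rewrite -[X in (X <= _)%N](card_ord q) -cardsT subset_leq_card //.
apply/subsetP => x _; have : rshift p x \in setT by [].
rewrite -cd ec ed ea eb epi porbit_prodl porbit_prodr inE.
case/orP => /imsetP[y yin]; last by move/rshift_inj => ->.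
by move/eqP; rewrite eq_rlshift.
Qed.

Section Existence2.
Variables (A : pzRingType) (C : comPzRingType).
Variables (phi2 : A -> A -> C) (kappa : seq A -> C).

Fixpoint cumulant2_rec fuel (s t : seq A) : C :=
  if fuel is m.+1 then
    phi2 (\prod_(x <- s) x) (\prod_(x <- t) x) -
    \sum_(Vpi in PSNC (size s) (size t) | Vpi != top_partitioned (size s) (size t))
       kappa_partitioned kappa (cumulant2_rec m) (fun i => nth 0 (s ++ t) i) Vpi
  else 0.

Lemma eq_kappa_partitioned (k k' : seq A -> seq A -> C) p q
   (a : 'I_(p + q) -> A) (Vpi : {set {set 'I_(p + q)}} * 'S_(p + q)) :
  (0 < p)%N -> (0 < q)%N -> Vpi \in PSNC p q -> Vpi != top_partitioned p q ->
  (forall w z, (0 < size w)%N -> (0 < size z)%N -> (size w + size z < p + q)%N -> k w z = k' w z) ->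
  kappa_partitioned kappa k a Vpi = kappa_partitioned kappa k' a Vpi.
Proof.
move=> p0 q0 mem ntop H; apply: eq_bigr => B BV; rewrite /kappa_block.
case E : [seq i <- enum B | leader Vpi.2 i] => [|i [|j [|? ?]]] //.
apply: H; rewrite ?cycle_args_gt0 // !size_cycle_args ltnNge.
by apply: contra ntop => full; apply/eqP/(PSNC_full p0 q0 mem BV E full).
Qed.

Lemma cumulant2_rec_stable m m' s t : (0 < size s)%N -> (0 < size t)%N ->
  (size s + size t <= m)%N -> (size s + size t <= m')%N -> cumulant2_rec m s t = cumulant2_rec m' s t.
Proof.
elim: m m' s t => [|m IH] [|m'] s t gs gt; try by case: (size s) gs.
move=> le le' /=; congr (_ - _); apply: eq_bigr => Vpi /andP[mem ntop].
apply: eq_kappa_partitioned => // w z w0 z0 lt.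
by apply: IH => //; rewrite -ltnS; apply: leq_trans lt _.
Qed.

Lemma second_order_cumulants_exist :
  exists kappa2, second_order_cumulants phi2 kappa kappa2.
Proof.
exists (fun s t => cumulant2_rec (size s + size t) s t) => s t s0 t0.
rewrite (bigD1 (top_partitioned (size s) (size t))) /=; last exact: top_partitioned_PSNC.
rewrite kappa_top //.
set m := (size s + size t).-1.
have -> : cumulant2_rec (size s + size t) s t = cumulant2_rec m.+1 s t by rewrite prednK // addn_gt0 s0.
rewrite /= -[LHS](subrK (\sum_(Vpi in PSNC (size s) (size t) | Vpi != top_partitioned (size s) (size t))
  kappa_partitioned kappa (cumulant2_rec m) (fun i => nth 0 (s ++ t) i) Vpi)).
congr (_ + _); apply: eq_bigr => Vpi /andP[mem ntop].
apply: eq_kappa_partitioned => // w z w0 z0 lt.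
by apply: cumulant2_rec_stable => //; rewrite -ltnS /m prednK // addn_gt0 s0.
Qed.
End Existence2.

(* Main.v *)
Require Import Defs.
From mathcomp Require Import all_boot all_order all_algebra all_fingroup.
From mathcomp Require Import reals complex.
From mathcomp Require Import zify.

Set Implicit Arguments.
Unset Strict Implicit.
Unset Printing Implicit Defensive.

Import GRing.Theory.

(* All free cumulants of a = x^2 are 1, since its moments are the Catalan
   numbers |NC(n)|.  As f |-> sum over the pairs of blocks of NC(p) x NC(q) is
   triangular, it suffices to check that the moment-cumulant relation
     phi_2(a^p, a^q) = |S_NC(p,q)| + sum_{(pi_1,c), (pi_2,d)} kappa_{|c|,|d|}
   holds for the claimed values.  The left side is
   2 sum_k k C(2p,p+k) C(2q,q+k), and both terms on the right are equal to half
   of it.  For the second one, C(2p-m-1,p-1) blocks of the elements of NC(p)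
   have size m, and sum_m C(2p-m-1,p-1) C(m,k) = C(2p,p+k).  For the first one,
   a permutation u is identified with the factorization g = (g u^-1) u, whose
   genus is read off from cycle counts: if u i = j, composing u and g with the
   transposition (i j) makes i a fixed point of u and cuts the cycle of g
   through i, or joins it to that of j.  In the disc this is the Catalan
   recursion (and u in NC(n) iff the factorization is planar); in the annulus
   it gives
     A(p,q) = 2 sum_j Cat_j A(p-1-j,q) + q Cat_{p+q-1},
   which sum_k k C(2p,p+k) C(2q,q+k) satisfies as well. *)

(** * Ballot numbers *)

(* z^n-coefficient of C(z)^m, C being the Catalan generating function. *)
Fixpoint ballot (n m : nat) : nat :=
  if n is n'.+1 then \sum_(i < m) ballot n' i.+2 else 1.

Arguments ballot : simpl never.

Definition catalan n := ballot n 1.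

(** The identity C^(m+1) = C^m + z C^(m+2), which is C = 1 + z C^2 multiplied by C^m. *)
Lemma ballotS n m : ballot n.+1 m.+1 = ballot n.+1 m + ballot n m.+2.
Proof. by rewrite /ballot big_ord_recr. Qed.

Lemma ballot0 n : ballot n 0 = (n == 0).
Proof. by case: n => // n; rewrite /ballot big_ord0. Qed.

Lemma catalan1 : catalan 1 = 1.
Proof. by rewrite /catalan ballotS ballot0. Qed.

(** Reflection principle, written additively to avoid truncated subtraction. *)
Lemma ballot_bin n m :
  ballot n.+1 m.+1 + 'C(n.*2 + m.+2, n) = 'C(n.*2 + m.+2, n.+1).
Proof.
elim: n m => [|n IHn] m.
  elim: m => [|m IH]; rewrite ballotS ?ballot0 !bin0 !bin1 /=.
    by [].
  by move: IH; rewrite bin0 bin1 [ballot 0 _]/ballot; lia.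
elim: m => [|m IHm].
  rewrite ballotS ballot0 /= add0n.
  have e : (n.+1).*2 + 2 = (n.*2 + 3).+1 by lia.
  rewrite e binS [RHS]binS.
  have := IHn 1; have := bin_sub; move=> /(_ (n.*2+3) n.+1).
  have -> : n.*2 + 3 - n.+1 = n.+2 by lia.
  move=> /(_ ltac:(lia)); lia.
rewrite ballotS.
have -> : (n.+1).*2 + m.+3 = ((n.+1).*2 + m.+2).+1 by lia.
rewrite binS [in RHS]binS; have := IHm; have := IHn m.+2.
have -> : n.*2 + m.+4 = (n.+1).*2 + m.+2 by lia.
lia.
Qed.

(** * Convolution with the Catalan numbers *)

Section Convolution.
Variable f : nat -> nat -> nat.
Hypothesis f0 : forall m, f 0 m = 1.
Hypothesis fS : forall n m, f n.+1 m.+1 = f n.+1 m + f n m.+2.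
Hypothesis conv0 : forall n, (forall k m, k < n ->
  \sum_(l < k.+1) catalan l * f (k - l) m = f k m.+1) ->
  \sum_(l < n.+1) catalan l * f (n - l) 0 = f n 1.

Lemma catalan_conv n m :
  \sum_(l < n.+1) catalan l * f (n - l) m = f n m.+1.
Proof.
elim/ltn_ind: n m => -[|n] IH m.
  by rewrite big_ord_recl big_ord0 /= !f0.
elim: m => [|m IHm]; first by apply: conv0 => k l lt; apply: IH.
rewrite fS -IHm -[in f n _]IH // big_ord_recr /= [in RHS]big_ord_recr /= subnn !f0.
rewrite [RHS]addnAC -big_split /=; congr (_ + _); apply: eq_bigr => l _.
by rewrite subSn ?fS ?mulnDr // -ltnS.
Qed.
End Convolution.

Lemma ballot_conv n m :
  \sum_(l < n.+1) catalan l * ballot (n - l) m = ballot n m.+1.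
Proof.
apply: catalan_conv => // [k l|k _]; first exact: ballotS.
rewrite big_ord_recr /= subnn big1 ?ballot0 ?muln1 // => i _.
by rewrite ballot0 subn_eq0 leqNgt ltn_ord muln0.
Qed.

Lemma catalanS n : \sum_(l < n.+1) catalan l * catalan (n - l) = catalan n.+1.
Proof. by rewrite ballot_conv [RHS]ballotS ballot0. Qed.

(** The z^n-coefficient of C(z)^m / sqrt(1 - 4z) is 'C(2n + m, n), so one more factor C(z) raises m
    by one. *)
Lemma bin_conv n m :
  \sum_(l < n.+1) catalan l * 'C((n - l).*2 + m, n - l) = 'C(n.*2 + m.+1, n).
Proof.
apply: (catalan_conv (f := fun n m => 'C(n.*2 + m, n))) => [k|k l|k IH]; first by rewrite bin0.
  have -> : (k.+1).*2 + l.+1 = (k.+1.*2 + l).+1 by lia.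
  by rewrite binS; congr (_ + 'C(_, _)); lia.
case: k IH => [|k] IH; first by rewrite big_ord_recl big_ord0.
rewrite big_ord_recr /= subnn bin0 muln1.
(* A central binomial coefficient is twice a neighbour in the row above; this turns column 0 at k +
   1 into column 1 at k, where the induction hypothesis applies. *)
have e (i : 'I_k.+1) : catalan i * 'C((k.+1 - i).*2 + 0, k.+1 - i) =
    2 * (catalan i * 'C((k - i).*2 + 1, k - i)).
  rewrite subSn -1?ltnS // addn0 doubleS binS.
  have := @bin_sub ((k - i).*2.+1) (k - i) ltac:(lia).
  have -> : (k - i).*2.+1 - (k - i) = (k - i).+1 by lia.
  by rewrite addn1 => ->; lia.
rewrite (eq_bigr _ (fun i _ => e i)) -big_distrr /= IH //.
have := ballot_bin k 0; rewrite /catalan.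
have -> : (k.+1).*2 + 1 = (k.*2 + 2).+1 by lia.
rewrite binS; lia.
Qed.

Lemma catalan_bin n : catalan n * n.+1 = 'C(n.*2, n).
Proof.
case: n => // n; have := ballot_bin n 0; rewrite addn2 -doubleS /catalan.
have := mul_bin_left (n.+1).*2 n.
have -> : (n.+1).*2 - n = n.+2 by lia.
nia.
Qed.

(** Sorts the subsets of {0, ..., N} with a + b + 1 elements by their element m that has b elements
    below it. *)
Lemma bin_hockey_stick N a b :
  \sum_(m < N.+1) 'C(N - m, a) * 'C(m, b) = 'C(N.+1, (a + b).+1).
Proof.
elim: N b => [|N IH] b.
  by rewrite big_ord_recl big_ord0 subnn !bin0n; case: a => [|a]; case: b.
case: b => [|b].
  rewrite big_ord_recl /= addn0 bin0 muln1 subn0 binS [RHS]addnC -[in 'C(_,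
    a.+1)](addn0 a) -IH.
  by congr (_ + _); apply: eq_bigr => i _; rewrite !bin0.
rewrite big_ord_recl muln0 add0n.
under eq_bigr => i _ do rewrite lift0 binS mulnDr subSS.
by rewrite big_split /= !IH binS addnS.
Qed.

Lemma ballot_mul n m : (n.*2 + m) * ballot n m = m * 'C(n.*2 + m, n).
Proof.
case: n m => [|n] [|m]; rewrite ?ballot0 ?muln0 // ?bin0 //.
have := ballot_bin n m; have := mul_bin_left (n.*2 + m.+2) n.
have -> : (n.+1).*2 + m.+1 = (n.*2 + m.+2).+1 by lia.
rewrite binS; have -> : n.*2 + m.+2 - n = n + m.+2 by lia.
nia.
Qed.

(** The left side counts the elements of NC(p) with a marked point in a cycle of size m, whose m
    gaps carry C(z)^m; division by m then counts the cycles of size m. *)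
Lemma ballot_block p m : 0 < m <= p ->
  p * ballot (p - m) m = m * 'C(p.*2 - m.+1, p.-1).
Proof.
case/andP=> m0 mp; have := ballot_mul (p - m) m.
have -> : (p - m).*2 + m = (p.*2 - m.+1).+1 by lia.
have := bin_sub (_ : p <= (p.*2 - m.+1).+1) => /(_ ltac:(lia)).
have -> : (p.*2 - m.+1).+1 - p = p - m by lia.
move=> ->; have := mul_bin_diag (p.*2 - m.+1).+1 p.-1.
rewrite /= prednK; nia.
Qed.

(* Counts the paths of length 2p - 1 from 0 to 2k - 1 staying nonnegative. *)
Definition half_path p k := if k <= p then ballot (p - k) k.*2 else 0.

Lemma half_path0 p : half_path p.+1 0 = 0.
Proof. by rewrite /half_path ballot0. Qed.

Lemma half_path_big p k : p < k -> half_path p k = 0.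
Proof. by move=> lt; rewrite /half_path leqNgt lt. Qed.

Lemma half_path1 k : half_path 1 k = (k == 1).
Proof. by case: k => [|[|k]] //; rewrite half_path0. Qed.

Lemma half_pathS p k :
  half_path p.+1 k.+1 = half_path p k + 2 * half_path p k.+1 + half_path p k.+2.
Proof.
have [lt|gt|<-] := ltngtP k p; last 1 first.
- by rewrite ![half_path k _.+1]half_path_big // /half_path !leqnn !subnn.
- have [e|lt2] := eqVneq p k.+1.
    rewrite (half_path_big (k := k.+2)) ?e //.
    rewrite /half_path !ifT; try lia.
    have -> : k.+2 - k.+1 = 1 by lia.
    have -> : k.+1 - k = 1 by lia.
    by rewrite subnn doubleS !ballotS /ballot; lia.
  rewrite /half_path !ifT ?doubleS; try lia.
  rewrite subSS -[p - k]prednK ?subn_gt0 // -subnS !ballotS.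
  rewrite -[p - k.+1]prednK ?subn_gt0; last lia.
  rewrite -subnS !ballotS; lia.
by rewrite !half_path_big //; lia.
Qed.

(** The recursion [half_pathS] is a symmetric operator in k up to boundary terms, which vanish, so
    two steps can be moved from one path to the other. *)
Lemma half_path_adjoint p q M : p.+1 < M -> q.+1 < M ->
  \sum_(k < M.+1) half_path p.+2 k * half_path q.+1 k =
  \sum_(k < M.+1) half_path p.+1 k * half_path q.+2 k.
Proof.
move=> pM qM.
have sh f g : f 0 = 0 -> f M.+1 = 0 -> 
    \sum_(k < M.+1) f k * g k.+1 = \sum_(k < M.+1) f k.+1 * g k.+2 :> nat.
  by move=> f0 fM; rewrite big_ord_recl [RHS]big_ord_recr /= f0 fM addn0.
have out (f g : nat -> nat) : f 0 = 0 -> f M.+1 = 0 ->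
    \sum_(k < M.+1) f k * g k = \sum_(k < M.+1) f k.+1 * g k.+1.
  by move=> f0 fM; rewrite big_ord_recl [RHS]big_ord_recr /= f0 fM addn0.
rewrite out ?half_path0 ?[RHS]out ?half_path0 // ?half_path_big //; try lia.
transitivity (\sum_(k < M.+1) (half_path p.+1 k * half_path q.+1 k.+1 +
  2 * (half_path p.+1 k.+1 * half_path q.+1 k.+1) +
  half_path q.+1 k.+1 * half_path p.+1 k.+2)).
  by apply: eq_bigr => k _; rewrite half_pathS; lia.
transitivity (\sum_(k < M.+1) (half_path p.+1 k.+1 * half_path q.+1 k.+2 +
  2 * (half_path p.+1 k.+1 * half_path q.+1 k.+1) +
  half_path q.+1 k * half_path p.+1 k.+1)).
  by rewrite !big_split /= !sh ?half_path0 ?half_path_big //; lia.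
by apply: eq_bigr => k _; rewrite [half_path q.+2 _]half_pathS; lia.
Qed.

(** A path and the reversal of another one, meeting at height 2k - 1, form a Dyck path of length 2(p
    + q + 1). Steps are moved to the second path until the first has length 1, which forces k =
    1. *)
Lemma half_path_glue p q M : p + q < M ->
  \sum_(k < M.+1) half_path p.+1 k * half_path q.+1 k = catalan (p + q).+1.
Proof.
elim: p q => [|p IH] q lt; last by rewrite half_path_adjoint ?IH ?addnS //; lia.
case: M lt => // M lt.
rewrite big_ord_recl half_path0 add0n big_ord_recl big1 => [|i _]; last first.
  by rewrite !lift0 half_path1.
rewrite lift0 half_path1 mul1n addn0 /half_path /= subSS.
by rewrite add0n /catalan ballotS ballot0 subn0.
Qed.

Lemma half_path_bin p k : half_path p.+1 k + 'C(p.*2.+1, (p + k).+1) = 'C(p.*2.+1, p + k).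
Proof.
case: k => [|k].
  rewrite half_path0 addn0; have := @bin_sub p.*2.+1 p ltac:(lia).
  by have -> : p.*2.+1 - p = p.+1 by lia.
rewrite /half_path; case: ltnP => [lt|le]; last by rewrite !bin_small //; lia.
rewrite subSS; have [->|ne] := eqVneq k p.
  rewrite subnn /ballot addnS -addnn bin_small; last lia.
  by rewrite -addnS addnS binn.
have := ballot_bin (p - k).-1 (k.*2.+1).
rewrite prednK ?subn_gt0 -?doubleS; last lia.
have -> : (p - k).-1.*2 + k.+1.*2.+1 = p.*2.+1 by lia.
have := @bin_sub p.*2.+1 (p - k) ltac:(lia).
have := @bin_sub p.*2.+1 (p - k).-1 ltac:(lia).
have -> : p.*2.+1 - (p - k) = p + k.+1 by lia.
have -> : p.*2.+1 - (p - k).-1 = (p + k.+1).+1 by lia.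
by move=> -> ->.
Qed.

Lemma half_path_mul q k : 0 < q -> q * half_path q k = k * 'C(q.*2, q + k).
Proof.
move=> q0; rewrite /half_path; case: leqP => [kq|lt]; last first.
  by rewrite muln0 bin_small ?muln0 //; lia.
have := ballot_mul (q - k) k.*2.
have -> : (q - k).*2 + k.*2 = q.*2 by lia.
have := @bin_sub q.*2 (q - k) ltac:(lia).
have -> : q.*2 - (q - k) = q + k by lia.
move=> ->; lia.
Qed.

(* The sum over k >= 0 stops at q, as 'C(q.*2, q + k) = 0 for k > q. *)
Definition annular p q := \sum_(k < q.+1) k * 'C(p.*2, p + k) * 'C(q.*2, q + k).

Lemma annular_widen p q M : q < M ->
  annular p q = \sum_(k < M) k * 'C(p.*2, p + k) * 'C(q.*2, q + k).
Proof.
move=> lt; rewrite /annular (big_ord_widen M (fun k => k * 'C(p.*2, p + k) * 'C(q.*2,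
  q + k))) //.
rewrite big_mkcond; apply: eq_bigr => k _; case: ltnP => // le.
by rewrite [X in _ = _ * X]bin_small ?muln0 //; lia.
Qed.

Lemma annular0 q : annular 0 q = 0.
Proof. by rewrite /annular big1 // => -[[|k] ? _]; rewrite ?mul0n // muln0. Qed.

(** This is [bin_conv] at (p - k, 2k) with complementary lower indices; the terms with j > p - k
    vanish. *)
Lemma bin_conv_shift p k :
  \sum_(j < p.+1) catalan j * 'C((p - j).*2, p - j + k) = 'C(p.*2.+1, (p + k).+1).
Proof.
case: (leqP k p) => [le|lt]; last first.
  rewrite bin_small ?big1 // => [i _|]; last lia.
  by rewrite bin_small ?muln0 //; lia.
have := @bin_sub p.*2.+1 (p - k) ltac:(lia).
have -> : p.*2.+1 - (p - k) = (p + k).+1 by lia.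
move=> ->; have := bin_conv (p - k) k.*2.
have -> : (p - k).*2 + k.*2.+1 = p.*2.+1 by lia.
move=> <-; rewrite -(big_mkord xpredT (fun j => catalan j * 'C((p - j).*2, p - j + k))).
rewrite (big_cat_nat (n := (p - k).+1)) //=; last lia.
rewrite [X in _ + X]big_nat_cond [X in _ + X]big1 ?addn0 ?big_mkord => [|i]; last first.
  by rewrite andbT => /andP[? ?]; rewrite bin_small ?muln0 //; lia.
apply: eq_bigr => i _.
have -> : (p - k - i).*2 + k.*2 = (p - i).*2 by case: i => /= *; lia.
congr (_ * _); rewrite -bin_sub; last by case: i => /= *; lia.
by congr ('C(_, _)); case: i => /= *; lia.
Qed.

(** By Pascal's rule and [half_path_bin], 'C(2p + 2, p + 1 + k) is twice 'C(2p + 1, p + k + 1) plus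
    [half_path p.+1 k]. The first part gives the convolution; in the second, k 'C(2q, q + k) is q
    times [half_path q k] and the paths are glued. *)
Lemma annularS p q : 0 < q ->
  annular p.+1 q = 2 * (\sum_(j < p.+1) catalan j * annular (p - j) q) + q * catalan (p + q).
Proof.
case: q => // q _; pose M := (p + q).+2.
have e1 : \sum_(j < p.+1) catalan j * annular (p - j) q.+1 =
    \sum_(k < M) k * 'C(p.*2.+1, (p + k).+1) * 'C(q.+1.*2, q.+1 + k).
  have qM : q.+1 < M by rewrite ltnS ltnS leq_addl.
  under eq_bigr => j _ do rewrite (annular_widen _ qM) big_distrr /=.
  rewrite exchange_big /=; apply: eq_bigr => k _.
  rewrite -bin_conv_shift big_distrr big_distrl /=; apply: eq_bigr => j _.
  by rewrite !mulnA [k * _]mulnC.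
have e2 : q.+1 * catalan (p + q.+1) = \sum_(k < M) k * half_path p.+1 k * 'C(q.+1.*2,
  q.+1 + k).
  rewrite addnS -(@half_path_glue p q (p + q).+1) // big_distrr; apply: eq_bigr => k _ /=.
  by rewrite mulnCA (half_path_mul k (ltn0Sn q)) mulnCA !mulnA.
rewrite e1 e2 (@annular_widen _ _ M) ?ltnS //; last by rewrite leq_addl.
rewrite big_distrr -big_split /=; apply: eq_bigr => k _.
rewrite doubleS addSn binS -half_path_bin.
by move: 'C(_, _) 'C(_, _) (half_path _ _) => a b c; nia.
Qed.

(** This is [bin_hockey_stick] with N = 2p - 1, a = p - 1, b = k, where the terms with m > p
    vanish. *)
Lemma block_choose_sum p k : 0 < p -> 0 < k ->
  \sum_(m < p.+1) 'C(p.*2 - m.+1, p.-1) * 'C(m, k) = 'C(p.*2, p + k).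
Proof.
move=> p0 k0; have := bin_hockey_stick p.*2.-1 p.-1 k.
rewrite prednK; last lia.
have -> : (p.-1 + k).+1 = p + k by lia.
move=> <-.
rewrite (big_ord_widen p.*2 (fun m => 'C(p.*2 - m.+1, p.-1) * 'C(m, k))); last lia.
rewrite big_mkcond; apply: eq_bigr => m _.
have -> : p.*2.-1 - m = p.*2 - m.+1 by lia.
have ltm := ltn_ord m; case: ltnP => // lt; rewrite bin_small //; lia.
Qed.

Lemma catalan_gt0 n : 0 < catalan n.
Proof. by have := catalan_bin n; case: catalan => //; rewrite mul0n => /esym/eqP;
  rewrite -leqn0 leqNgt bin_gt0; lia. Qed.

(** The Catalan recursion in the shape given by the choice of u i on a cycle of length m: first u i
    = i, then the m - 1 other points. *)
Lemma catalan_split m : 0 < m ->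
  catalan m.-1 + \sum_(k < m.-1) catalan k * catalan (m.-1 - k) = catalan m.
Proof. by case: m => //= m _; rewrite -catalanS big_ord_recr subnn /= muln1 addnC. Qed.

(* z^m-coefficient of (z C(z))^k. *)
Definition block_path m k := if k <= m then ballot (m - k) k else 0.

(** Multiplication of (z C(z))^k by z C(z); for k > 0 there is no constant term, hence no term a =
    m. *)
Lemma block_path_conv m k : 0 < k ->
  \sum_(a < m) catalan a * block_path (m - a) k = block_path m.+1 k.+1.
Proof.
move=> k0; rewrite /block_path ltnS subSS; case: leqP => [le|lt]; last first.
  rewrite big1 // => i _; case: leqP; rewrite ?muln0 //; lia.
rewrite -ballot_conv (big_ord_widen m (fun a => catalan a * ballot (m - k - a) k)); last lia.
rewrite [RHS]big_mkcond; apply: eq_bigr => a _.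
have -> : (k <= m - a) = (a < (m - k).+1) by have := ltn_ord a; lia.
by case: ifP; rewrite ?muln0 // => _; rewrite subnAC.
Qed.

Lemma block_path1 m : 0 < m -> block_path m 1 = catalan m.-1.
Proof. by case: m => // m _; rewrite /block_path subSS subn0. Qed.

(** Rearranges [annularS] by the position of u i for a point i of the first circle: on the second
    circle, at i, or elsewhere on the first circle. The last case leaves pieces of k and p - 1 - k
    points, one of which carries the crossing. *)
Lemma annular_split p q : 0 < p -> 0 < q ->
  annular p q = q * catalan (p + q).-1 + annular p.-1 q +
   \sum_(k < p.-1) (annular k q * catalan (p.-1 - k) + catalan k * annular (p.-1 - k) q).
Proof.
case: p => // p _ q0; rewrite annularS //= big_split /=.
have S1 : \sum_(j < p.+1) catalan j * annular (p - j) q =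
    \sum_(j < p) catalan j * annular (p - j) q.
  by rewrite big_ord_recr /= subnn annular0 muln0 addn0.
have S2 : \sum_(j < p.+1) catalan j * annular (p - j) q =
    \sum_(j < p) annular j q * catalan (p - j) + annular p q.
  rewrite (reindex_inj rev_ord_inj) big_ord_recr /= subSS subnn subn0 mul1n; congr (_ + _).
  by apply: eq_bigr => k _; rewrite subSS mulnC subKn // ltnW.
rewrite mul2n -addnn {1}S2 S1 [RHS]addnC -!addnA; congr (_ + _).
by rewrite addnC -addnA.
Qed.

(** * Cutting and joining cycles *)

Section Cycles.
Variable T : finType.
Implicit Types (s t g u : {perm T}) (x y z i j : T).
Local Open Scope group_scope.

Lemma mem_porbit1 s x : s x \in porbit s x.
Proof. by have := mem_porbit s 1 x; rewrite expg1. Qed.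

Lemma porbit_step s x y : (s y \in porbit s x) = (y \in porbit s x).
Proof. by rewrite -!eq_porbit_mem; have := porbit_perm s 1 y; rewrite expg1 => ->. Qed.

Lemma porbit_sub s x (A : {set T}) : x \in A -> (forall y, y \in A -> s y \in A) ->
  porbit s x \subset A.
Proof.
move=> xA st; apply/subsetP => _ /porbitP[k ->].
by elim: k => [|k IH]; rewrite ?expg0 ?perm1 // expgSr permM st.
Qed.

Lemma eq_porbit_in s t x : {in porbit s x, s =1 t} -> porbit t x = porbit s x.
Proof.
move=> e; have it k : (t ^+ k) x = (s ^+ k) x.
  by elim: k => // k IH; rewrite !expgSr !permM IH -e ?mem_porbit.
by apply/setP=> y; apply/porbitP/porbitP => -[k ->]; exists k.
Qed.

Lemma porbits_mul_tpermr s x y :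
  #|porbits (s * tperm x y)| + (x \notin porbit s y).*2 = #|porbits s| + (x != y).
Proof.
have -> : s * tperm x y = tperm (s^-1 x) (s^-1 y) * s.
  by rewrite -tpermJ conjgE invgK -mulgA mulgKV.
have := porbits_mul_tperm s (s^-1 x) (s^-1 y).
rewrite (inj_eq perm_inj) /=; congr (_ + (~~ _).*2 = _).
by rewrite -{2}(permKV s x) -{2}(permKV s y) porbit_step porbit_sym -(porbit_step _ _ (s^-1
  y)) porbit_sym.
Qed.

Lemma porbits_fix_tperm s x : s x != x ->
  #|porbits (s * tperm x (s x))| = #|porbits s|.+1.
Proof.
move=> nx; have := porbits_mul_tpermr s x (s x).
by rewrite porbit_sym mem_porbit1 eq_sym nx addn0 addn1.
Qed.

Lemma leq_porbits s : #|porbits s| <= #|T|.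
Proof. by rewrite leq_imset_card. Qed.

Lemma porbits1 : #|porbits (1 : {perm T})| = #|T|.
Proof.
rewrite card_imset // => x y /eqP; rewrite eq_porbit_mem => /porbitP[k ->].
by rewrite expg1n perm1.
Qed.

(** Triangle inequality for the length |T| - #(s), the least number of transpositions with product
    s. The induction strips one transposition off s at a time. *)
Lemma leq_porbits_mul s t : #|porbits s| + #|porbits t| <= #|T| + #|porbits (t * s)|.
Proof.
have [n le] := ubnP (#|T| - #|porbits s|); elim: n s le => // n IH s le.
have [s1|] := boolP [forall x, s x == x].
  have -> : s = 1 by apply/permP => x; rewrite perm1; apply/eqP; exact: (forallP s1).
  by rewrite mulg1 porbits1.
rewrite negb_forall => /existsP[x nx].
have e := porbits_fix_tperm nx; set t' := tperm x (s x) in e.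
have le1 := leq_porbits (s * t'); rewrite e in le1.
have := IH (s * t'); rewrite e mulgA => IHs.
have {}IHs := IHs ltac:(lia).
have := porbits_mul_tpermr (t * s) x (s x); rewrite -/t'.
rewrite eq_sym nx => e2; move: IHs e2; move: #|porbits (_ * _ * _)|;
  move: #|porbits (t * s)| => c c'.
case: (_ \notin _); rewrite ?doubleS ?double0 /=; lia.
Qed.

(* Half the excess is the total genus of the map (u, g * u^-1), plus the number
   of cycles of g, minus the number of orbits of <g, u>. *)
Definition excess e g u :=
  #|porbits u| + #|porbits (g * u^-1)| + e == #|T| + #|porbits g|.

Lemma porbits_quotient g u : #|porbits u| + #|porbits (g * u^-1)| <= #|T| + #|porbits g|.
Proof. by have := leq_porbits_mul u (g * u^-1); rewrite mulgKV. Qed.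

Lemma mul_tpermV g u x y : (g * tperm x y) * (u * tperm x y)^-1 = g * u^-1.
Proof. by rewrite invMg mulgA mulgK. Qed.

(** Here the transposition cuts a cycle of g: both u and g gain a cycle, and g u^-1 is unchanged. *)
Lemma excess_join e g u i : u i != i -> u i \in porbit g i ->
  excess e g u = excess e (g * tperm i (u i)) (u * tperm i (u i)).
Proof.
move=> ni ig; rewrite /excess mul_tpermV porbits_fix_tperm //.
have := porbits_mul_tpermr g i (u i); rewrite porbit_sym ig eq_sym ni; lia.
Qed.

(** Here the transposition joins two cycles of g: #(u) grows and #(g) drops by one, which costs
    2. *)
Lemma excess_cut e g u i : u i \notin porbit g i ->
  excess e.+2 g u = excess e (g * tperm i (u i)) (u * tperm i (u i)).
Proof.
move=> ig; have ni : u i != i by apply: contraNneq ig => ->; apply: porbit_id.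
rewrite /excess mul_tpermV porbits_fix_tperm //.
have := porbits_mul_tpermr g i (u i); rewrite porbit_sym ig eq_sym ni; lia.
Qed.

(** A jump between two cycles of g would, as in [excess_cut], lead to a negative excess, against
    [porbits_quotient]. *)
Lemma excess0_stable g u i : excess 0 g u -> u i \in porbit g i.
Proof.
move=> ex; apply: contraT => ig.
have ni : u i != i by apply: contraNneq ig => ->; apply: porbit_id.
have := porbits_quotient (g * tperm i (u i)) (u * tperm i (u i)).
rewrite mul_tpermV porbits_fix_tperm //.
have := porbits_mul_tpermr g i (u i); rewrite porbit_sym ig eq_sym ni.
by move/eqP: ex; lia.
Qed.

Definition isolate i s := s * tperm i (s i).

Lemma isolate_id i s : s i = i -> isolate i s = s.
Proof. by rewrite /isolate => ->; rewrite tperm1 mulg1. Qed.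

Lemma isolateE i s : isolate i s i = i.
Proof. by rewrite permM tpermR. Qed.

Lemma isolate_neq s i y : y != i -> s y != i -> isolate i s y = s y.
Proof.
move=> yi syi; rewrite permM tpermD //; first by rewrite eq_sym.
by rewrite (inj_eq perm_inj) eq_sym.
Qed.

(** As u fixes i, taking i out of its cycle in g takes it out of its cycle in g u^-1 too, so both
    counts grow by one. *)
Lemma excess_isolate e g u i : u i = i -> excess e g u = excess e (isolate i g) u.
Proof.
move=> ui; have [gi|ngi] := eqVneq (g i) i; first by rewrite isolate_id.
rewrite /excess porbits_fix_tperm //.
have ui' : u^-1 i = i by rewrite -{1}ui permK.
have e1 : tperm i ((g * u^-1) i) = tperm i (g i) ^ u^-1 by rewrite tpermJ ui' permM.
have -> : isolate i g * u^-1 = g * u^-1 * tperm i ((g * u^-1) i).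
  by rewrite e1 conjgE invgK !mulgA mulgKV.
rewrite porbits_fix_tperm; first lia.
by rewrite permM -{2}ui' (inj_eq perm_inj).
Qed.

(** * Cutting a cycle at two of its points *)

Section Cut.
Variables (s : {perm T}) (x y : T).
Hypothesis xy : y \in porbit s x.
Let s' := s * tperm x y.

Lemma porbit_cut_out z : z \notin porbit s x -> porbit s' z = porbit s z.
Proof.
move=> zx; apply: eq_porbit_in => w wz; rewrite permM tpermD //.
  by apply: contraNneq zx => e; rewrite porbit_sym e porbit_step.
apply: contraNneq zx => e; move: xy; rewrite -eq_porbit_mem => /eqP <-.
by rewrite porbit_sym e porbit_step.
Qed.

Lemma porbit_cutU : porbit s' x :|: porbit s' y = porbit s x.
Proof.
have tst z : (tperm x y z \in porbit s x) = (z \in porbit s x).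
  by case: tpermP => [->|->|//]; rewrite xy porbit_id.
apply/eqP; rewrite eqEsubset subUset -andbA; apply/and3P; split.
- by apply: porbit_sub => [|z zx]; rewrite ?porbit_id // permM tst porbit_step.
- by apply: porbit_sub => [|z zx]; rewrite // permM tst porbit_step.
apply: porbit_sub => [|z]; first by rewrite inE porbit_id.
have -> : s z = tperm x y (s' z) by rewrite permM tpermK.
have: (s' z \in porbit s' x :|: porbit s' y) = (z \in porbit s' x :|: porbit s' y).
  by rewrite !inE !porbit_step.
move=> <-; move: (s' z) => w.
by case: tpermP => [-> _|-> _|//]; rewrite !inE porbit_id ?orbT.
Qed.

Hypothesis nxy : y != x.

(** By counting: s' has one cycle more than s, so a second multiplication by the transposition has
    to join two cycles. *)
Lemma porbit_cut_disjoint : y \notin porbit s' x.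
Proof.
have := porbits_mul_tpermr s' x y; have := porbits_mul_tpermr s x y.
rewrite -/s' /s' -mulgA tperm2 mulg1 porbit_sym xy eq_sym nxy porbit_sym /= addn0 => -> /eqP.
by rewrite -addnA eqn_add2l; case: (_ \notin _).
Qed.

Lemma porbits_cut :
  porbits s' = porbit s' x |: (porbit s' y |: (porbits s :\ porbit s x)).
Proof.
apply/setP=> C; rewrite !inE; apply/imsetP/idP => [[z _ ->]|].
  have [zx|zx] := boolP (z \in porbit s x); last first.
    rewrite porbit_cut_out // imset_f // eq_porbit_mem zx; by rewrite !orbT.
  by move: zx; rewrite -porbit_cutU inE -!eq_porbit_mem => /orP[]->; rewrite ?orbT.
case/or3P => [/eqP->|/eqP->|/andP[nC /imsetP[z _ e]]]; [by exists x|by exists y|].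
by exists z => //; rewrite porbit_cut_out // -eq_porbit_mem -e.
Qed.

(** The number of planar factorizations of the argument, by [card_excess0]: one non-crossing
    partition on each cycle. *)
Definition weight (u : {perm T}) := (\prod_(C in porbits u) catalan #|C|)%N.

Lemma weight_cut :
  (weight s' * catalan #|porbit s x| = catalan #|porbit s' x| * catalan #|porbit s' y| *
    weight s)%N.
Proof.
have nO z : z \in porbit s x -> porbit s' z \notin porbits s :\ porbit s x.
  move=> zx; apply/negP; rewrite !inE => /andP[ne /imsetP[w _ e]].
  have : z \in porbit s w by rewrite -e porbit_id.
  by rewrite -eq_porbit_mem -e eq_sym; move: zx; rewrite -eq_porbit_mem => /eqP ->; exact/negP.
have ne : porbit s' x != porbit s' y by rewrite eq_sym eq_porbit_mem porbit_cut_disjoint.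
rewrite /weight porbits_cut big_setU1 ?big_setU1 /=; last 2 first.
- exact: nO.
- by rewrite in_setU1 negb_or nO ?porbit_id // andbT; exact: ne.
rewrite [in RHS](big_setD1 (porbit s x)) ?imset_f //=; lia.
Qed.

Lemma card_cut : #|porbit s' x| + #|porbit s' y| = #|porbit s x|.
Proof.
rewrite -porbit_cutU cardsU; suff -> : porbit s' x :&: porbit s' y = set0 by
  rewrite cards0 subn0.
apply/eqP; rewrite setI_eq0; apply/pred0P => z /=; apply/negP => /andP[].
rewrite -!eq_porbit_mem => /eqP e1 /eqP e2; move: porbit_cut_disjoint.
by rewrite -eq_porbit_mem -e1 -e2 eqxx.
Qed.

End Cut.

(** The new cycle of x is x, s x, ..., s^(k-1) x: the next point would be s^k x, which the
    transposition sends back to x. *)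
Lemma card_cut_traject s x k : 0 < k < #|porbit s x| ->
  #|porbit (s * tperm x (iter k s x)) x| = k.
Proof.
case/andP=> k0 km; set s' := s * _.
have ne a b : a < b < #|porbit s x| -> iter a s x != iter b s x.
  case/andP=> ab bm; have un := uniq_traject_porbit s x.
  apply/eqP => e; have := ltn_eqF ab.
  have := nth_uniq x _ _ un; rewrite size_traject => /(_ a b (ltn_trans ab bm) bm).
  by rewrite !nth_traject ?(ltn_trans ab) // e eqxx => <-.
have it a : a < k -> iter a s' x = iter a s x.
  elim: a => //= a IH ak; rewrite IH ?(ltnW ak) // permM -iterS tpermD //.
    by apply: (ne 0); rewrite ltn0Sn (ltn_trans ak).
  by rewrite eq_sym; apply: ne; rewrite ak km.
have itk : iter k s' x = x.
  by rewrite -(prednK k0) /= it ?prednK // permM -iterS prednK // tpermR.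
have -> : porbit s' x = [set iter a s x | a : 'I_k].
  apply/setP=> z; apply/porbitP/imsetP => [[a ->]|[a _ ->]]; last first.
    by exists a; rewrite permX it.
  exists (Ordinal (ltn_pmod a k0)) => //=; rewrite permX -it ?ltn_pmod //.
  rewrite {1}(divn_eq a k) addnC iterD; congr (iter _ _ _).
  by elim: (a %/ k) => // b IH; rewrite mulSn iterD IH itk.
rewrite card_imset ?card_ord // => a b e; apply: val_inj => /=.
case: (ltngtP a b) => // ab; have := ne _ _ (_ : _ < _ < _).
  by move=> /(_ a b); rewrite ab (ltn_trans (ltn_ord b)) // e eqxx => /(_ isT).
by move=> /(_ b a); rewrite ab (ltn_trans (ltn_ord a)) // e eqxx => /(_ isT).
Qed.

Lemma sum_porbit s x (f : T -> nat) :
  \sum_(y in porbit s x) f y = \sum_(k < #|porbit s x|) f (iter k s x).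
Proof.
rewrite (eq_bigl _ _ (porbit_traject s x)) -big_uniq ?uniq_traject_porbit //=.
set m := #|_|; rewrite -[in LHS](map_id (traject _ _ _)).
have -> : traject s x m = [seq iter k s x | k <- iota 0 m].
  apply: (@eq_from_nth _ x); rewrite ?size_map ?size_iota size_traject // => k km.
  by rewrite nth_traject // (nth_map 0) ?size_iota // nth_iota.
by rewrite map_id big_map -(big_mkord xpredT (fun k => f (iter k s x))) /index_iota subn0.
Qed.

Section Isolate.
Variables (s : {perm T}) (i : T).

Lemma porbit_fix u x : u x = x -> porbit u x = [set x].
Proof.
move=> e; apply/eqP; rewrite eqEsubset sub1set porbit_id andbT.
by apply: porbit_sub => [|y]; rewrite !inE // => /eqP ->; rewrite e.
Qed.

Lemma porbit_isolate1 : porbit (isolate i s) i = [set i].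
Proof. exact/porbit_fix/isolateE. Qed.

Lemma porbit_isolate_out z : z \notin porbit s i -> porbit (isolate i s) z = porbit s z.
Proof. by move=> zi; rewrite porbit_cut_out ?mem_porbit1. Qed.

Lemma porbit_isolate_in z : z \in porbit s i -> z != i ->
  porbit (isolate i s) z = porbit s i :\ i.
Proof.
move=> zi zni; have [e|ne] := eqVneq (s i) i.
  by rewrite porbit_fix // inE (negPf zni) in zi.
have io := mem_porbit1 s i.
have := porbit_cutU io; have := porbit_cut_disjoint io ne.
rewrite -/(isolate i s) porbit_isolate1 => sii U.
have -> : porbit s i :\ i = porbit (isolate i s) (s i).
  rewrite -U; apply/setP=> w; rewrite !inE; case: eqP => //= ->.
  by rewrite porbit_sym porbit_isolate1 (negPf sii).
by apply/eqP; rewrite eq_porbit_mem; move: zi; rewrite -U !inE (negPf zni).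
Qed.

Lemma weight_isolate : (weight (isolate i s) * catalan #|porbit s i| =
  catalan #|porbit s i|.-1 * weight s)%N.
Proof.
have [e|ne] := eqVneq (s i) i.
  by rewrite isolate_id // porbit_fix // cards1 catalan1 mulnC.
have io := mem_porbit1 s i.
rewrite /isolate weight_cut // -/(isolate i s) porbit_isolate1 cards1 catalan1 mul1n.
by rewrite (porbit_isolate_in io ne) (cardsD1 i (porbit s i)) porbit_id.
Qed.

End Isolate.

End Cycles.

(** * Counting planar factorizations *)

Section Count.
Variable T : finType.
Implicit Types (s t g u : {perm T}) (x y z i j : T).

(* When u i = j, u * tperm i j fixes i, so that i may also be removed from the
   cycle of g * tperm i j containing it. *)
Definition peel g i j := isolate i (g * tperm i j)%g.

Lemma peel_id g i : peel g i i = isolate i g.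
Proof. by rewrite /peel tperm1 mulg1. Qed.

Lemma excess_peel e g u i j : j \in porbit g i -> u i = i ->
  excess e g (u * tperm i j)%g = excess e (peel g i j) u.
Proof.
move=> ji ui; rewrite -excess_isolate //; have [->|ne] := eqVneq j i.
  by rewrite tperm1 !mulg1.
have e1 : (u * tperm i j)%g i = j by rewrite permM ui tpermL.
by rewrite (excess_join _ (i := i)) e1 // -mulgA tperm2 mulg1.
Qed.

Lemma tperm_fixE u i j : ((u * tperm i j)%g i == j) = (u i == i).
Proof. by rewrite permM -{2}(tpermL i j) (inj_eq perm_inj). Qed.

Lemma excess0_fix g u i : g i = i -> excess 0 g u -> u i = i.
Proof. by move=> gi /(excess0_stable i); rewrite porbit_fix // inE => /eqP. Qed.

(** Sorts u by j = u i. Multiplication by (i j) is a bijection onto the planar u of [peel g i j],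
    all of which fix i because [peel g i j] does. *)
Lemma sum_excess0 g i (f : {perm T} -> nat) :
  \sum_(u | excess 0 g u) f u =
  \sum_(j in porbit g i) \sum_(u | excess 0 (peel g i j) u) f (u * tperm i j)%g.
Proof.
rewrite (partition_big (fun u : {perm T} => u i) (mem (porbit g i))) /=; last first.
  by move=> u; apply: excess0_stable.
apply: eq_bigr => j ji; rewrite (reindex_inj (mulIg (tperm i j))) /=.
apply: eq_bigl => u; rewrite tperm_fixE; apply/andP/idP => [[ex /eqP ui]|ex].
  by rewrite -excess_peel.
have ui : u i = i by apply: excess0_fix ex; apply: isolateE.
by rewrite excess_peel // ui eqxx.
Qed.

Lemma card_porbit_gt0 s x : (0 < #|porbit s x|)%N.
Proof. by rewrite lt0n card_porbit_neq0. Qed.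

Lemma sum_porbit_recl s x (f : T -> nat) :
  \sum_(y in porbit s x) f y =
  f x + \sum_(k < #|porbit s x|.-1) f (iter k.+1 s x).
Proof. by rewrite sum_porbit; case: #|_| (card_porbit_gt0 s x) => // m _;
  rewrite big_ord_recl. Qed.

Section Peel.
Variables (g : {perm T}) (i : T) (k : nat).
Hypothesis km : 0 < k < #|porbit g i|.
Let j := iter k g i.

Lemma iter_neq : j != i.
Proof.
case/andP: km => k0 lt; have := uniq_traject_porbit g i; apply: contraTneq => e.
rewrite -(prednK (card_porbit_gt0 g i)) /= negb_and negbK; apply/orP; left.
apply/trajectP; exists k.-1; first by rewrite -ltnS !prednK ?card_porbit_gt0.
by rewrite -iterSr prednK.
Qed.

Lemma iter_porbit_in : j \in porbit g i.
Proof. by rewrite /j -permX mem_porbit. Qed.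

Lemma card_cut_left : #|porbit (g * tperm i j)%g i| = k.
Proof. exact: card_cut_traject. Qed.

Lemma card_cut_right : #|porbit (g * tperm i j)%g j| = #|porbit g i| - k.
Proof. by rewrite -(card_cut iter_porbit_in iter_neq) card_cut_left addKn. Qed.

Lemma peel_notin : j \notin porbit (g * tperm i j)%g i.
Proof. exact: porbit_cut_disjoint iter_porbit_in iter_neq. Qed.

Lemma porbit_peel : porbit (peel g i j) j = porbit (g * tperm i j)%g j.
Proof. exact: porbit_isolate_out peel_notin. Qed.

(** Of the two pieces, of lengths k and m - k, the first contains i and shrinks to k - 1 points. *)
Lemma weight_peel :
  weight (peel g i j) * catalan #|porbit g i| =
  catalan k.-1 * catalan (#|porbit g i| - k) * weight g.
Proof.
have := weight_isolate (g * tperm i j)%g i.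
have := weight_cut iter_porbit_in iter_neq.
rewrite card_cut_left card_cut_right -/(peel g i j) => e1 e2.
apply/eqP; rewrite -(eqn_pmul2r (catalan_gt0 k)); apply/eqP.
by rewrite mulnAC e2 -mulnA e1; lia.
Qed.

Lemma card_porbits_peel : #|porbits g| < #|porbits (peel g i j)|.
Proof.
apply: (@leq_trans #|porbits (g * tperm i j)%g|).
  have := porbits_mul_tpermr g i j.
  by rewrite porbit_sym iter_porbit_in eq_sym iter_neq addn0 addn1 => ->.
rewrite /peel; have [e|ne] := eqVneq ((g * tperm i j)%g i) i; first by rewrite isolate_id.
by rewrite porbits_fix_tperm.
Qed.

End Peel.

(** Induction on |T| - #(g), which drops at each peeling. For a point i moved by g, the sum over u i
    is the Catalan recursion for the cycle of i; the other cycles only contribute a common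
    factor. *)
Lemma card_excess0 g : \sum_(u | excess 0 g u) 1 = weight g.
Proof.
have [n le] := ubnP (#|T| - #|porbits g|); elim: n g le => // n IH g le.
have [g1|] := boolP [forall x, g x == x].
  have -> : g = 1%g by apply/permP => x; rewrite perm1; apply/eqP; exact: (forallP g1).
  rewrite (big_pred1 1%g) => [|u]; last first.
    apply/idP/eqP => [ex|->]; last by rewrite /excess invg1 mulg1 porbits1 addn0.
    by apply/permP => x; rewrite perm1; apply: excess0_fix ex; rewrite perm1.
  rewrite /weight big1 // => C /imsetP[x _ ->].
  by rewrite porbit_fix ?perm1 // cards1 catalan1.
rewrite negb_forall => /existsP[i ni]; set m := #|porbit g i|.
have m0 : 0 < m := card_porbit_gt0 g i.
rewrite (sum_excess0 g i) sum_porbit_recl -/m peel_id;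
  have lt u : #|porbits g| < #|porbits u| -> #|T| - #|porbits u| < n.
  by have := leq_porbits u; lia.
rewrite (IH (isolate i g)); last by rewrite lt // porbits_fix_tperm.
(* The factor [catalan m] turns quotients of weights into the products of [weight_isolate] and
   [weight_peel]. *)
apply/eqP; rewrite -(eqn_pmul2r (catalan_gt0 m)); apply/eqP.
rewrite mulnDl weight_isolate -/m big_distrl /=.
have tm (k : 'I_m.-1) : (\sum_(u | excess 0 (peel g i (iter k.+1 g i)) u) 1) * catalan m =
  catalan k * catalan (m.-1 - k) * weight g.
  have km : 0 < k.+1 < m by have := ltn_ord k; lia.
  rewrite IH ?lt ?card_porbits_peel //.
  by rewrite weight_peel // -/m; congr (_ * catalan _ * _); lia.
by rewrite (eq_bigr _ (fun k _ => tm k)) -big_distrl /= -mulnDl catalan_split // mulnC.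
Qed.

Lemma card_porbit_insert g i j u : j != i -> excess 0 (peel g i j) u ->
  #|porbit (u * tperm i j)%g i| = #|porbit u j|.+1.
Proof.
move=> ne ex; have ui : u i = i := excess0_fix (isolateE i _) ex.
set s := (u * tperm i j)%g; have si : s i = j by rewrite permM ui tpermL.
have su : isolate i s = u by rewrite /isolate si -mulgA tperm2 mulg1.
rewrite -{1}su (porbit_isolate_in _ ne) ?(cardsD1 i (porbit s i)) ?porbit_id //.
by rewrite -si mem_porbit1.
Qed.

(** Each point of the cycle of i in u, with the gap after it, carries a factor z C(z). The induction
    passes from i to j = u i: the a points skipped carry [catalan a], and the cycle of j in the
    peeled u is one shorter. *)
Lemma sum_excess0_block g i k :
  (\sum_(u | excess 0 g u) (#|porbit u i| == k.+1)) * catalan #|porbit g i| =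
  block_path #|porbit g i| k.+1 * weight g.
Proof.
elim: k g i => [|k IH] g i; set m := #|porbit g i|; have m0 : 0 < m := card_porbit_gt0 g i.
  (* For a cycle of size 1 only j = i contributes; for the larger sizes below, only j != i does. *)
  rewrite (sum_excess0 g i) sum_porbit_recl -/m peel_id [X in _ + X]big1 => [|k _]; last first.
    have km : 0 < k.+1 < m by have := ltn_ord k; lia.
    rewrite big1 // => u ex; rewrite (card_porbit_insert (iter_neq km) ex).
    by rewrite eqSS (negPf (card_porbit_neq0 _ _)).
  rewrite addn0 (eq_bigr (fun _ => 1)) => [|u ex]; last first.
    by rewrite tperm1 mulg1 porbit_fix ?cards1 // (excess0_fix (isolateE i _) ex).
  by rewrite card_excess0 weight_isolate block_path1.
rewrite (sum_excess0 g i) sum_porbit_recl -/m peel_id [X in X + _]big1 => [|u ex]; last first.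
  by rewrite tperm1 mulg1 porbit_fix ?cards1 // (excess0_fix (isolateE i _) ex).
have -> : block_path m k.+2 = \sum_(a < m.-1) catalan a * block_path (m.-1 - a) k.+1.
  by rewrite block_path_conv ?prednK.
rewrite add0n !big_distrl /=; apply: eq_bigr => a _.
have am : 0 < a.+1 < m by have := ltn_ord a; lia.
set j := iter a.+1 g i; have cj : #|porbit (peel g i j) j| = m.-1 - a.
  by rewrite (porbit_peel am) (card_cut_right am) -/m; lia.
have := IH (peel g i j) j; rewrite cj => e.
apply/eqP; rewrite -(eqn_pmul2r (catalan_gt0 (m.-1 - a))); apply/eqP.
rewrite mulnAC (eq_bigr (fun u => nat_of_bool (#|porbit u j| == k.+1))) => [|u ex]; last first.
  by rewrite (card_porbit_insert (iter_neq am) ex) eqSS.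
rewrite e -mulnA (weight_peel am) -/m /=.
have -> : m - a.+1 = m.-1 - a by lia.
by rewrite -!mulnA mulnCA; congr (_ * (_ * _)); rewrite mulnC.
Qed.

End Count.

(** * Counting annular factorizations *)

Section Annular.
Variable T : finType.
Implicit Types (s t g u : {perm T}) (x y z i j : T) (X Y : {set T}).

(** * Joining two cycles, the inverse of a cut *)

Section Join.
Variables (s : {perm T}) (x y : T).
Hypothesis xy : y \notin porbit s x.
Let s' := (s * tperm x y)%g.

Lemma mulg_tpermK : (s' * tperm x y)%g = s.
Proof. by rewrite -mulgA tperm2 mulg1. Qed.

Lemma join_neq : y != x.
Proof. by apply: contraNneq xy => ->; apply: porbit_id. Qed.

Lemma porbit_join_in : y \in porbit s' x.
Proof.
have := porbits_mul_tpermr s' x y; have := porbits_mul_tpermr s x y.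
rewrite mulg_tpermK -/s' porbit_sym xy eq_sym join_neq porbit_sym.
by move: #|porbits s| #|porbits s'| => a b; case: (_ \in porbit _ _) => //=; lia.
Qed.

Lemma porbit_joinU : porbit s' x = porbit s x :|: porbit s y.
Proof. by rewrite -(porbit_cutU porbit_join_in) mulg_tpermK. Qed.

Lemma porbit_join_out z : z \notin porbit s x :|: porbit s y -> porbit s' z = porbit s z.
Proof. by rewrite -porbit_joinU => /(porbit_cut_out porbit_join_in); rewrite mulg_tpermK. Qed.

Lemma weight_join : weight s * catalan #|porbit s' x| =
  catalan #|porbit s x| * catalan #|porbit s y| * weight s'.
Proof. by have := weight_cut porbit_join_in join_neq; rewrite mulg_tpermK. Qed.

Lemma card_join : #|porbit s' x| = #|porbit s x| + #|porbit s y|.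
Proof. by rewrite -(card_cut porbit_join_in join_neq) mulg_tpermK. Qed.

End Join.

Section Excess2.
Variables (g u : {perm T}) (i : T).
Hypotheses (ex : excess 2 g u) (cut : u i \notin porbit g i).

(** One jump between cycles of g uses up the whole excess; once the two cycles are joined,
    [excess0_stable] governs all values. *)
Lemma excess2_cut : excess 0 (g * tperm i (u i))%g (u * tperm i (u i))%g.
Proof. by rewrite -excess_cut. Qed.

Lemma excess2_out z : z \notin porbit g i :|: porbit g (u i) -> u z \in porbit g z.
Proof.
move=> zU; have := excess0_stable z excess2_cut; rewrite porbit_join_out // permM.
case: tpermP => [_ ui| _ /=|//]; last first.
  by move=> iz; rewrite inE porbit_sym iz in zU.
by rewrite inE negb_or andbC porbit_sym ui in zU.
Qed.

Lemma excess2_in z : z \in porbit g i :|: porbit g (u i) ->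
  u z \in porbit g i :|: porbit g (u i).
Proof.
rewrite -porbit_joinU // => zU; have := excess0_stable z excess2_cut.
rewrite -eq_porbit_mem in zU; rewrite (eqP zU) permM.
by case: tpermP => [->|->|//] _; rewrite ?porbit_id ?porbit_join_in.
Qed.
End Excess2.

Definition crosses X Y u := [exists i in X, u i \in Y].

Lemma crosses0 Y u : crosses set0 Y u = false.
Proof. by apply/negbTE/exists_inPn => i; rewrite inE. Qed.

Lemma crossesU X1 X2 Y u : crosses (X1 :|: X2) Y u = crosses X1 Y u || crosses X2 Y u.
Proof.
apply/exists_inP/orP => [[x]|[] /exists_inP[i iX iY]].
- by rewrite inE => /orP[] xX xY; [left|right]; apply/exists_inP; exists x.
- by exists i => //; rewrite inE iX.
- by exists i => //; rewrite inE iX orbT.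
Qed.

Lemma crosses_tperm X Y u i j : i \in X -> i \notin Y -> j \notin Y -> u i = i ->
  crosses X Y (u * tperm i j)%g = crosses (X :\ i) Y u.
Proof.
move=> iX iY jY ui; apply/exists_inP/exists_inP => -[x].
  move=> xX; rewrite permM; case: tpermP => [_|_|]; rewrite ?(negPf jY) ?(negPf iY) //.
  by move=> /eqP ni _ uY; exists x => //; rewrite !inE xX andbT; apply: contraNneq ni =>
    ->; rewrite ui.
rewrite !inE => /andP[xi xX] uxY; exists x => //; rewrite permM tpermD //.
  by apply: contraNneq iY => ->.
by apply: contraNneq jY => ->.
Qed.

Lemma porbits_disjoint g X Y x : X \in porbits g -> Y \in porbits g -> X != Y ->
  x \in X -> x \notin Y.
Proof.
move=> /imsetP[a _ ->] /imsetP[b _ ->] ne; rewrite -eq_porbit_mem => /eqP e.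
by rewrite -eq_porbit_mem e.
Qed.

(** If u jumps from X1 to Y, then by [excess2_out] it preserves every other cycle, in particular
    X2. *)
Lemma crosses_excl g X1 X2 Y u : excess 2 g u ->
  X1 \in porbits g -> X2 \in porbits g -> Y \in porbits g ->
  X1 != X2 -> X1 != Y -> X2 != Y -> crosses X1 Y u -> ~~ crosses X2 Y u.
Proof.
move=> ex o1 o2 oY n12 n1 n2 /exists_inP[a aX aY]; apply/exists_inPn => b bX.
have e1 : X1 = porbit g a by case/imsetP: o1 aX => c _ ->; rewrite -eq_porbit_mem => /eqP ->.
have e2 : X2 = porbit g b by case/imsetP: o2 bX => c _ ->; rewrite -eq_porbit_mem => /eqP ->.
have e3 : Y = porbit g (u a) by case/imsetP: oY aY => c _ ->; rewrite -eq_porbit_mem =>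
  /eqP ->.
have := @excess2_out g u a ex _ b; rewrite -e1 -e2 -e3 => H.
apply: (porbits_disjoint o2 oY n2); apply: H.
  by apply: (porbits_disjoint oY o1) => //; rewrite eq_sym.
rewrite inE negb_or (porbits_disjoint o2 oY) // andbT.
by apply: (porbits_disjoint o2 o1) => //; rewrite eq_sym.
Qed.

Definition ncross g X Y := \sum_(u | excess 2 g u && crosses X Y u) 1.

Lemma ncrossU g X1 X2 Y : X1 \in porbits g -> X2 \in porbits g -> Y \in porbits g ->
  X1 != X2 -> X1 != Y -> X2 != Y -> ncross g (X1 :|: X2) Y = ncross g X1 Y + ncross g X2 Y.
Proof.
move=> o1 o2 oY n12 n1 n2; rewrite /ncross (bigID (crosses X1 Y)) /=; congr (_ + _);
  apply: eq_bigl => u.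
  by rewrite crossesU -andbA; congr (_ && _); case: crosses; rewrite ?andbF.
rewrite crossesU -andbA; case: (boolP (excess 2 g u)) => //= ex.
have := crosses_excl ex o1 o2 oY n12 n1 n2.
by case: (crosses X1 _ _) => //= [/(_ isT)/negPf ->|_]; rewrite ?andbT.
Qed.

Section Step.
Variables (g : {perm T}) (X Y : {set T}) (i : T).
Hypotheses (oX : X \in porbits g) (oY : Y \in porbits g) (nXY : X != Y) (iX : i \in X).

Let eX : X = porbit g i.
Proof. by case/imsetP: oX iX => c _ ->; rewrite -eq_porbit_mem => /eqP ->. Qed.

Let eY j : j \in Y -> Y = porbit g j.
Proof. by case/imsetP: oY => c _ ->; rewrite -eq_porbit_mem => /eqP ->. Qed.

Let iY : i \notin Y. Proof. exact: (porbits_disjoint oX oY). Qed.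

Lemma porbit_peel_out j z : j \in X -> z \notin X -> porbit (peel g i j) z = porbit g z.
Proof.
rewrite eX => jX zX; rewrite porbit_isolate_out; first by rewrite (porbit_cut_out jX).
by apply: contra zX; rewrite -(porbit_cutU jX) inE => ->.
Qed.

Lemma ncross_in j : j \in X ->
  \sum_(u | (excess 2 g u && crosses X Y u) && (u i == j)) 1 = ncross (peel g i j) (X :\ i) Y.
Proof.
move=> jX; have jY := porbits_disjoint oX oY nXY jX.
rewrite (reindex_inj (mulIg (tperm i j))) /=; apply: eq_bigl => u.
rewrite tperm_fixE; have [ui|ni] := eqVneq (u i) i.
  by rewrite andbT excess_peel -?eX // crosses_tperm.
(* Every u counted on the right fixes i: a crossing leaves all cycles but the two involved stable,
   and {i} is such a cycle of [peel g i j]. *)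
rewrite andbF; apply/esym/negbTE/negP => /andP[ex /exists_inP[x]].
rewrite !inE => /andP[xi xX] xY.
have nYX : Y != X by rewrite eq_sym.
have pY : porbit (peel g i j) (u x) = Y.
  by rewrite porbit_peel_out -?(eY xY) //; apply: (porbits_disjoint oY oX).
have pi : porbit (peel g i j) i = [set i] by apply: porbit_isolate1.
have := @excess2_out _ _ x ex _ i; rewrite pY pi inE (negPf ni) => H.
suff: false by []; apply: H.
  by rewrite porbit_sym pY (porbits_disjoint oX oY).
by rewrite inE negb_or iY andbT porbit_sym pi inE.
Qed.

(** The transposition (i j) joins X and Y and spends the excess; the rest is a planar count on a
    cycle of |X| + |Y| - 1 points. *)
Lemma ncross_cross j : j \in Y ->
  (\sum_(u | (excess 2 g u && crosses X Y u) && (u i ==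
    j)) 1) * (catalan #|X| * catalan #|Y|) =
  catalan (#|X| + #|Y|).-1 * weight g.
Proof.
move=> jY; have jX : j \notin porbit g i.
  by rewrite -eX; apply: (porbits_disjoint oY oX) => //; rewrite eq_sym.
have -> : \sum_(u | (excess 2 g u && crosses X Y u) && (u i == j)) 1 = weight (peel g i j).
  rewrite (reindex_inj (mulIg (tperm i j))) /= -card_excess0; apply: eq_bigl => u.
  rewrite tperm_fixE; have [ui|ni] := eqVneq (u i) i; last first.
    by rewrite andbF; apply/esym/negbTE; apply: contra ni => /(excess0_fix (isolateE i _)) ->.
  have e : (u * tperm i j)%g i = j by rewrite permM ui tpermL.
  have -> : crosses X Y (u * tperm i j)%g by apply/exists_inP; exists i; rewrite ?e.
  by rewrite !andbT (excess_cut _ (i := i)) e // mulg_tpermK -excess_isolate.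
have := weight_isolate (g * tperm i j)%g i; have := weight_join jX.
rewrite (card_join jX) -eX -(eY jY) => e1 e2.
apply/eqP; rewrite -(eqn_pmul2r (catalan_gt0 (#|X| + #|Y|))); apply/eqP.
by rewrite mulnAC e2 -[RHS]mulnA e1 -!mulnA; congr (_ * _); rewrite mulnC mulnA.
Qed.

Lemma ncross_out j : j \notin X -> j \notin Y ->
  \sum_(u | (excess 2 g u && crosses X Y u) && (u i == j)) 1 = 0.
Proof.
move=> jX jY; rewrite big_pred0 // => u; apply/negbTE/negP => /andP[/andP[ex cr] /eqP uij].
case/exists_inP: cr => x xX xY; have := @excess2_in _ _ i ex _ x.
rewrite uij -eX inE xX => /(_ jX isT); rewrite inE => /orP[uX|uj].
  by have := porbits_disjoint oX oY nXY uX; rewrite xY.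
by move: jY; rewrite (eY xY) porbit_sym uj.
Qed.

End Step.

Lemma ncross0 g Y : ncross g set0 Y = 0.
Proof. by rewrite /ncross big_pred0 // => u; rewrite crosses0 andbF. Qed.

Lemma isolate_orbit s i : porbit s i :\ i = set0 \/ porbit s i :\ i \in porbits (isolate i s).
Proof.
have [->|/set0Pn[z zi]] := eqVneq (porbit s i :\ i) set0; [by left|right].
by move: zi; rewrite !inE => /andP[zi zO]; rewrite -(porbit_isolate_in zO zi) imset_f.
Qed.

(** Combines the recursive count on a piece with the weight identity of a peeling, and divides by
    the Catalan number [a] of the piece. *)
Lemma cancel_weight n a b p q A w w' : 0 < a -> n * (a * q) = A * w -> w * p = a * b * w' ->
  n * (p * q) = A * b * w'.
Proof.
move=> a0 e1 e2; apply/eqP; rewrite -(eqn_pmul2l a0); apply/eqP.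
have -> : a * (n * (p * q)) = n * (a * q) * p by lia.
by rewrite e1 -mulnA e2; lia.
Qed.

Lemma ncrossE g X Y : X = set0 \/ X \in porbits g -> Y \in porbits g -> X != Y ->
  ncross g X Y * (catalan #|X| * catalan #|Y|) = annular #|X| #|Y| * weight g.
Proof.
have [n le] := ubnP #|X|; elim: n g X le => // n IH g X le.
have [-> _ _ _|/set0Pn[i iX]] := eqVneq X set0.
  by rewrite ncross0 cards0 annular0.
case=> [e|oX oY nXY]; first by rewrite e inE in iX.
have eX : X = porbit g i by case/imsetP: oX iX => c _ ->; rewrite -eq_porbit_mem => /eqP ->.
have q0 : 0 < #|Y| by case/imsetP: oY => c _ ->; apply: card_porbit_gt0.
have p0 : 0 < #|X| by rewrite eX card_porbit_gt0.
rewrite {1}/ncross (partition_big (fun u : {perm T} => u i) xpredT) //=.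
rewrite (bigID (mem X)) /= [Z in _ + Z](bigID (mem Y)) /= [Z in _ + (_ + Z)]big1 => [|j];
  last first.
  by case/andP=> jX jY; apply: ncross_out jX jY.
rewrite addn0 mulnDl.
have -> : (\sum_(j | (j \notin X) && (j \in Y)) \sum_(u | (excess 2 g u && crosses X Y u)
  && (u i == j)) 1) *
   (catalan #|X| * catalan #|Y|) = #|Y| * (catalan (#|X| + #|Y|).-1 * weight g).
  rewrite big_distrl /= -sum_nat_const; apply: eq_big => j.
    have [jY|] := boolP (j \in Y); rewrite ?andbF ?andbT //.
    by apply: (porbits_disjoint oY oX) => //; rewrite eq_sym.
  by case/andP=> _ jY; apply: ncross_cross.
under eq_bigr => j jX do rewrite ncross_in //.
rewrite [in \sum_(j in X) _]eX sum_porbit_recl -eX peel_id.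
rewrite annular_split // !mulnDl addnC -mulnA -addnA; congr (_ + _).
have lt1 : #|X :\ i| < n by rewrite -ltnS (leq_trans _ le) // ltnS [X in _ < X](cardsD1 i) iX.
have c1 : #|X :\ i| = #|X|.-1 by rewrite (cardsD1 i X) iX.
have nY (Z : {set T}) : Z \subset X -> Z != Y.
  move=> ZX; apply: contraTneq q0 => e; rewrite -e; apply/negP => /card_gt0P[z zZ].
  have zX := subsetP ZX z zZ.
  by have := porbits_disjoint oX oY nXY zX; rewrite -e zZ.
have oYp j : j \in X -> Y \in porbits (peel g i j).
  move=> jX; case/imsetP: (oY) => c _ e.
  have cX : c \notin X by apply: (porbits_disjoint oY oX); rewrite 1?eq_sym // e porbit_id.
  by rewrite e -(porbit_peel_out oX iX jX cX) imset_f.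
congr (_ + _).
  rewrite -[annular _ _]muln1; apply: (cancel_weight (catalan_gt0 #|X|.-1)).
    rewrite -c1; apply: IH => //; last by rewrite nY ?subsetDl.
      by rewrite eX; apply: isolate_orbit.
    by rewrite -peel_id oYp.
  by rewrite muln1 eX weight_isolate.
rewrite !big_distrl /=; apply: eq_bigr => k _.
have km : 0 < k.+1 < #|porbit g i| by rewrite -eX; have := ltn_ord k; lia.
set j := iter k.+1 g i; set s := (g * tperm i j)%g.
have jX : j \in X by rewrite eX; apply: iter_porbit_in.
have XU : X = porbit s i :|: porbit s j by rewrite porbit_cutU -?eX.
have ji : i \notin porbit s j by rewrite porbit_sym; apply: peel_notin.
have XiU : X :\ i = (porbit s i :\ i) :|: porbit s j.
  apply/setP => z; rewrite XU !inE; case: eqP => //= ->; exact/esym/negbTE.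
have cA : #|porbit s i :\ i| = k.
  by have := card_cut_left km; rewrite (cardsD1 i) porbit_id => -[].
have cB : #|porbit s j| = #|X|.-1 - k.
  by rewrite (card_cut_right km) -eX; lia.
have oB : porbit s j \in porbits (peel g i j) by rewrite -(porbit_peel km) imset_f.
have oA := isolate_orbit s i.
have AX : porbit s i :\ i \subset X by rewrite XU subsetU // subsetDl.
have BX : porbit s j \subset X by rewrite XU subsetUr.
(* What is left of X consists of two pieces, the first possibly empty; a crossing starts in exactly
   one of them. *)
have -> : ncross (peel g i j) (X :\ i) Y =
    ncross (peel g i j) (porbit s i :\ i) Y + ncross (peel g i j) (porbit s j) Y.
  rewrite XiU; case: oA => [->|oA]; first by rewrite set0U ncross0.
  apply: ncrossU; rewrite ?oYp ?nY //.
  apply/eqP => /setP/(_ j); rewrite porbit_id !inE => /andP[_].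
  by rewrite (negPf (peel_notin km)).
have w := weight_peel km; rewrite -/j -eX /= in w.
have eq : #|X| - k.+1 = #|X|.-1 - k by lia.
rewrite eq in w; rewrite !mulnDl; congr (_ + _).
  apply: (cancel_weight (catalan_gt0 k)) w; rewrite -cA.
  by apply: IH; rewrite ?oYp ?nY // cA; have := ltn_ord k; lia.
rewrite [catalan k * _]mulnC; apply: (cancel_weight (w :=
  weight (peel g i j)) (catalan_gt0 (#|X|.-1 - k))); last first.
  by rewrite w [catalan k * _]mulnC.
rewrite -cB; apply: IH; rewrite ?oYp ?nY ?cB //; [|by right].
by have := ltn_ord k; lia.
Qed.

End Annular.

(** * Non-crossing partitions *)

Lemma exists_leader n (u : 'S_n) i : exists2 m, leader u m & porbit u m = porbit u i.
Proof.
case: (arg_minnP (fun j : 'I_n => nat_of_ord j) (porbit_id u i)) => m mi min.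
have e : porbit u m = porbit u i by apply/eqP; rewrite eq_porbit_mem.
by exists m => //; apply/forall_inP => j; rewrite e => /min.
Qed.

Section Nested.
Variable n : nat.
Implicit Types (u : 'S_n.+1) (i j x y : 'I_n.+1).

(** An arc-by-arc form of membership in NC: it captures both the increasing order and the absence of
    crossings, and can be compared with the excess one transposition at a time. *)
Definition nested u := forall i x, i < x < u i -> i < u x < u i.

Lemma nested_porbit u i x y : nested u -> i < x < u i -> y \in porbit u x -> i < y < u i.
Proof.
move=> nu ix; suff /subsetP H : porbit u x \subset [set z : 'I_n.+1 | i < z < u i].
  by move/H; rewrite inE.
by apply: porbit_sub => [|z]; rewrite !inE // => /nu.
Qed.

Lemma nested_gap u i y : nested u -> y \in porbit u i -> ~~ (i < y < u i).
Proof.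
move=> nu; apply: contraL => iy; rewrite porbit_sym.
by apply/negP => /(nested_porbit nu iy); rewrite ltnn.
Qed.

Lemma iter_straddle u i x k : i <= x < iter k u i ->
  exists2 l, l < k & iter l u i <= x < iter l.+1 u i.
Proof.
elim: k => [|k IH] /andP[ix xk]; first by move: ix; rewrite leqNgt xk.
case: (ltnP x (iter k u i)) => [lt|le]; last by exists k; rewrite // le.
by case: IH => [|l lk xl]; [rewrite ix|exists l; rewrite // ltnW].
Qed.

Lemma noncrossing_porbits u :
  reflect (forall a b c d : 'I_n.+1, a < b -> b < c -> c < d ->
             c \in porbit u a -> d \in porbit u b -> b \in porbit u a)
          (noncrossing (porbits u)).
Proof.
apply: (iffP forall_inP) => [nc a b c d ab bc cd ca db|nc _ /imsetP[x _ ->]].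
  apply: contraT => ba; have := nc _ (imset_f _ (isT : a \in 'I_n.+1)).
  move=> /forall_inP/(_ _ (imset_f _ (isT : b \in 'I_n.+1))).
  rewrite eq_sym eq_porbit_mem ba /= => /exists_inP[]; exists a; rewrite ?porbit_id //.
  apply/exists_inP; exists b; rewrite ?porbit_id //.
  apply/exists_inP; exists c => //; apply/exists_inP; exists d => //.
  by rewrite ab bc.
apply/forall_inP => _ /imsetP[y _ ->]; apply/implyP => ne.
apply: contra ne => /exists_inP[a ax /exists_inP[b bx /exists_inP[c cx /exists_inP[d dx]]]].
case/and3P => ab bc cd; move: ax bx; rewrite -!eq_porbit_mem => /eqP ea /eqP eb.
rewrite -ea -eb eq_sym eq_porbit_mem; rewrite -ea in cx; rewrite -eb in dx.
exact: nc ab bc cd cx dx.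
Qed.

Lemma NC_nested u : u \in NC n.+1 -> nested u.
Proof.
rewrite inE => /andP[/forallP inc /noncrossing_porbits nc] i x /andP[ix xu].
(* The cycle of i is listed increasingly and i, u i are neighbours in the list, so x, strictly
   between them, is not on it. *)
have xi : x \notin porbit u i.
  apply/negP; have [m lm lmi] := exists_leader u i; rewrite -lmi => xm.
  have im : i \in porbit u m by rewrite lmi porbit_id.
  have := implyP (inc m) lm; set s := fingraph.orbit u m => srt.
  have nthE k : k < size s -> nth m s k = iter k u m.
    by move=> km; rewrite /s /fingraph.orbit nth_traject -?size_orbit.
  rewrite -!mem_orb -/s in xm im.
  have ia : iter (index i s) u m = i by rewrite -nthE ?index_mem ?nth_index.
  have xa : iter (index x s) u m = x by rewrite -nthE ?index_mem ?nth_index.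
  have homo a b : a < b < size s -> iter a u m < iter b u m.
    move=> /andP[ab bs]; have as_ := ltn_trans ab bs.
    have := sorted_ltn_nth ltn_trans 0 srt; move=> /(_ a b).
    by rewrite !inE size_map as_ bs !(nth_map m) // !nthE // => ->.
  have [] := ltngtP (index i s) (index x s) => [lt|lt|e].
  - have [e|lt'] := eqVneq (index i s).+1 (index x s).
      by move: xu; rewrite -xa -e /= ia ltnn.
    have := homo (index i s).+1 (index x s); rewrite index_mem xm ltn_neqAle lt' lt xa /= ia.
    by move/(_ isT); lia.
  - by have := homo _ _ (introT andP (conj lt _)); rewrite xa ia index_mem im => /(_ isT); lia.
  by move: ix; rewrite -ia e xa ltnn.
have ui := mem_porbit1 u i; have ux := mem_porbit1 u x.
have ex : porbit u (u x) = porbit u x by apply/eqP; rewrite eq_porbit_mem.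
(* Each of the four ways for u x to leave the interval puts x on the cycle of i, directly or because
   cycles do not cross. *)
apply/andP; split; rewrite ltnNge leq_eqVlt; apply/norP; split.
- by apply: contra xi => /eqP/val_inj e; rewrite porbit_sym -e.
- apply: contra xi => lt; rewrite porbit_sym -ex.
  by apply: nc lt ix xu _ ui; rewrite ex porbit_id.
- by apply: contra xi => /eqP/val_inj/perm_inj <-; rewrite porbit_id.
by apply: contra xi => lt; apply: nc ix xu lt ui ux.
Qed.

Lemma nested_NC u : nested u -> u \in NC n.+1.
Proof.
move=> nu; rewrite inE; apply/andP; split.
  apply/forallP => i; apply/implyP => /forall_inP li.
  apply/(sortedP 0) => k; rewrite size_map => km.
  rewrite !(nth_map i) ?(ltnW km) //.
  have un := orbit_uniq u i.
  rewrite /fingraph.orbit size_traject in km un *.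
  rewrite !nth_traject ?(ltnW km) //= ltnNge; apply/negP => le.
  have ne l : l <= k -> iter l u i != iter k.+1 u i.
    move=> lk; have := nth_uniq i _ _ un; rewrite size_traject.
    move=> /(_ l k.+1 (leq_ltn_trans lk (ltnW km)) km).
    rewrite !nth_traject ?(leq_ltn_trans lk (ltnW km)) // => ->.
    by rewrite ltn_eqF.
  (* As i is the least element, a descent before the cycle closes lands inside an earlier arc of the
     same cycle, against [nested_gap]. *)
  have st : i <= iter k.+1 u i < iter k u i.
    rewrite ltn_neqAle le eq_sym (ne k) // andbT li //.
    by rewrite -permX mem_porbit.
  have [l lk /andP[lx xl]] := iter_straddle st.
  have lxl : iter l u i < iter k.+1 u i < u (iter l u i).
    by rewrite xl ltn_neqAle lx (ne l) // ltnW.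
  suff /(nested_gap nu)/negP[] : iter k.+1 u i \in porbit u (iter l u i) by [].
  by rewrite -eq_porbit_mem -!permX !porbit_perm.
apply/noncrossing_porbits => a b c d ab bc cd /porbitP[k ec] db.
(* On the way from a to c the cycle jumps over b by an arc from z to u z. It encloses the cycle of
   b, hence d and also c, against [nested_gap]. *)
rewrite permX in ec; have st : a <= b < iter k u a by rewrite ltnW // -ec.
apply: contraT => ba; have [l _] := iter_straddle st.
rewrite iterS -permX; set z := (u ^+ l)%g a => /andP[zb bz].
have za : z \in porbit u a by apply: mem_porbit.
have ez : porbit u z = porbit u a by apply/eqP; rewrite eq_porbit_mem.
have zbz : z < b < u z.
  rewrite bz ltn_neqAle zb !andbT.
  by apply: contraNneq ba => /val_inj <-.
have /andP[_ dz] := nested_porbit nu zbz db.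
have := @nested_gap u z c nu; rewrite ez ec -permX mem_porbit permX -ec => /(_ isT).
by rewrite (leq_ltn_trans zb bc) (ltn_trans cd dz).
Qed.

Lemma excess0_nested u : excess 0 (gamma n.+1) u -> nested u.
Proof.
move=> ex i x /andP[ix xu].
set j := u i in xu *; have ni : u i != i by rewrite -val_eqE /= -/j; lia.
rewrite (excess_join _ ni) ?porbit_gamma ?inE // in ex.
(* After composition of gamma with (i j), the point j - 1 goes to i, so [i, j) is stable; by
   [excess0_stable] it is stable under u composed with (i j) as well. *)
pose I := [set z : 'I_n.+1 | i <= z < j].
have st z : z \in I -> porbit (gamma n.+1 * tperm i j)%g z \subset I.
  move=> zI; apply: porbit_sub => // y; rewrite !inE permM => /andP[iy yj].
  have gy : gamma n.+1 y = y.+1 :> nat.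
    by rewrite permE /= modn_small //; have := ltn_ord j; lia.
  case: tpermP => [e|e|_ /eqP gj]; rewrite ?leqnn /=.
  - by move: (congr1 val e); rewrite /= gy; lia.
  - lia.
  by move: gj; rewrite -val_eqE /= gy; lia.
have xI : x \in I by rewrite inE; lia.
have := subsetP (st x xI) _ (excess0_stable x ex); rewrite permM.
case: tpermP => [->|/perm_inj e|/eqP ne _]; rewrite ?inE ?ltnn ?andbF //.
  by rewrite e ltnn in ix.
by rewrite (ltn_neqAle i) eq_sym ne.
Qed.

(** The only new arc goes from u^-1 i to u i. If it ascends, its interior consists of the interiors
    of two old arcs and the point i. *)
Lemma nested_isolate u i : nested u -> i < u i -> nested (isolate i u).
Proof.
move=> nu iu y x.
have [->|yi] := eqVneq y i; first by rewrite isolateE; lia.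
have [->|xi] := eqVneq x i; first by rewrite !isolateE.
have [e|uyi] := eqVneq (u y) i; last first.
  rewrite (isolate_neq yi uyi) => xy; have := nu _ _ xy.
  have [e|uxi] := eqVneq (u x) i; last by rewrite (isolate_neq xi uxi).
  have -> : isolate i u x = u i by rewrite permM e tpermL.
  by rewrite e => /nu.
have -> : isolate i u y = u i by rewrite permM e tpermL.
move=> /andP[yx xu].
have uxi : u x != i.
  by rewrite -e (inj_eq perm_inj) -val_eqE /=; lia.
rewrite (isolate_neq xi uxi).
have yi' : y < i.
  rewrite ltn_neqAle val_eqE yi leqNgt; apply/negP => iy.
  by have := nu i y; rewrite iy (ltn_trans yx xu) e ltnn => /(_ isT).
have [xi'|ix|/val_inj eix] := ltngtP x i; last by rewrite eix eqxx in xi.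
  by have := nu y x; rewrite e yx xi' => /(_ isT)/andP[-> /= /ltn_trans ->].
by have := nu i x; rewrite ix xu => /(_ isT)/andP[/(ltn_trans yi') -> ->].
Qed.

Lemma nested_excess0 u : nested u -> excess 0 (gamma n.+1) u.
Proof.
have [k le] := ubnP (#|'I_n.+1| - #|porbits u|); elim: k u le => // k IH u le nu.
have [/existsP[i iu]|/existsPn un] := boolP [exists i : 'I_n.+1, i < u i]; last first.
  (* Without ascending arcs u is the identity: by induction, a value u i < i is already taken as the
     image of a fixed point. *)
  have -> : u = 1%g.
    apply/permP => i; rewrite perm1; move: {2}(val i).+1 (ltnSn i) => m.
    elim: m i => // m IHm i im; apply/eqP; apply: contraT => ne.
    have lt : u i < i by have := un i; move: ne; rewrite -val_eqE /=; lia.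
    by have /perm_inj e := IHm (u i) (leq_trans lt im); rewrite e eqxx in ne.
  by rewrite /excess invg1 mulg1 porbits1 addn0.
have ni : u i != i by rewrite -val_eqE /=; lia.
have c := porbits_fix_tperm ni.
have le1 := leq_porbits (isolate i u); rewrite c in le1.
have := IH (isolate i u); rewrite c card_ord => /(_ _ (nested_isolate nu iu)).
rewrite card_ord in le le1 *; move=> /(_ ltac:(lia)).
rewrite /excess c; set s := (gamma n.+1 * u^-1)%g; set h := (u^-1)%g i.
have -> : (gamma n.+1 * (isolate i u)^-1 = s * tperm h i)%g.
  rewrite /isolate invMg tpermV mulgA /s.
  have -> : tperm h i = (tperm i (u i) ^ u^-1)%g by rewrite tpermJ permK tpermC.
  by rewrite conjgE invgK !mulgA mulgKV.
(* The excess stays 0 if h = u^-1 i and i lie on distinct cycles of g u^-1. That of i stays in [i, u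
   i), and h in there would give i < u h = i. *)
have hin : h \notin porbit s i.
  have sub : porbit s i \subset [set z : 'I_n.+1 | i <= z < u i].
    apply: porbit_sub => [|z]; rewrite !inE ?leqnn // => /andP[iz zu].
    have gz : gamma n.+1 z = z.+1 :> nat.
      by rewrite permE /= modn_small //; have := ltn_ord (u i); lia.
    rewrite /s permM; have [e|ne] := eqVneq (gamma n.+1 z) (u i).
      by rewrite e permK leqnn.
    have iz' : i < gamma n.+1 z < u i.
      by rewrite gz; move: ne; rewrite -val_eqE /= gz; lia.
    have := nested_porbit (y := (u^-1 (gamma n.+1 z))%g) nu iz'.
    have := mem_porbit1 u (u^-1 (gamma n.+1 z))%g; rewrite permKV porbit_sym.
    by move=> zi /(_ zi)/andP[/ltnW -> ->].
  apply/negP => /(subsetP sub); rewrite inE => /andP[ih hu].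
  have uh : u h = i by rewrite permKV.
  have hi : h != i by apply: contraNneq ni => e; rewrite -{1}e uh.
  have ihu : i < h < u i by rewrite hu ltn_neqAle ih !andbT eq_sym val_eqE.
  by have := nu _ _ ihu; rewrite uh ltnn.
have hi : h != i by apply: contraNneq hin => ->; rewrite porbit_id.
have := porbits_mul_tpermr s h i; rewrite hin hi.
move: #|porbits s| #|porbits (s * tperm h i)%g| #|porbits u| #|porbits _| => *; lia.
Qed.

Lemma NC_excess0 u : (u \in NC n.+1) = excess 0 (gamma n.+1) u.
Proof.
by apply/idP/idP => [/NC_nested/nested_excess0|/excess0_nested/nested_NC].
Qed.
End Nested.

(** * The annulus *)

Section Annulus.
Variables p q : nat.

Lemma split_part (x : 'I_(p + q)) : (x \in left_part p q) = (x \notin right_part p q).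
Proof.
rewrite -(splitK x); case: (split x) => y /=.
  by rewrite imset_f //; apply/esym/imsetP => -[z _ /eqP]; rewrite eq_lrshift.
by rewrite [in RHS]imset_f //=; apply/negbTE/imsetP => -[z _ /eqP]; rewrite eq_rlshift.
Qed.

Definition lset (c : {set 'I_p}) : {set 'I_(p + q)} := [set lshift q j | j in c].
Definition rset (d : {set 'I_q}) : {set 'I_(p + q)} := [set rshift p j | j in d].

Lemma lset_sub c : lset c \subset left_part p q.
Proof. by apply/subsetP => _ /imsetP[x _ ->]; apply: imset_f. Qed.

Lemma rset_sub d : rset d \subset right_part p q.
Proof. by apply/subsetP => _ /imsetP[x _ ->]; apply: imset_f. Qed.

Lemma mem_lset c i : (lshift q i \in lset c) = (i \in c).
Proof. by rewrite mem_imset //; apply: lshift_inj. Qed.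

Lemma mem_rset d i : (rshift p i \in rset d) = (i \in d).
Proof. by rewrite mem_imset //; apply: rshift_inj. Qed.

Lemma lset_rshift c j : (rshift p j \in lset c) = false.
Proof. by apply/imsetP => -[z _ /eqP]; rewrite eq_rlshift. Qed.

Lemma rset_lshift d i : (lshift q i \in rset d) = false.
Proof. by apply/imsetP => -[z _ /eqP]; rewrite eq_lrshift. Qed.

Lemma porbits_prod (u : 'S_p) (v : 'S_q) :
  porbits (perm_prod u v) = (lset @: porbits u) :|: (rset @: porbits v).
Proof.
apply/setP => B; rewrite inE; apply/imsetP/orP => [[x _ ->]|].
  rewrite -(splitK x); case: (split x) => y /=; [left|right].
    by rewrite porbit_prodl; apply: imset_f; apply: imset_f.
  by rewrite porbit_prodr; apply: imset_f; apply: imset_f.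
case=> /imsetP[_ /imsetP[x _ ->] ->].
  by exists (lshift q x); rewrite ?porbit_prodl.
by exists (rshift p x); rewrite ?porbit_prodr.
Qed.

Lemma perm_prod_inj (u u' : 'S_p) (v v' : 'S_q) :
  perm_prod u v = perm_prod u' v' -> u = u' /\ v = v'.
Proof.
move=> e; split; apply/permP => i.
  by apply: (@lshift_inj p q); rewrite -(perm_prodl u v) e perm_prodl.
by apply: (@rshift_inj p q); rewrite -(perm_prodr u v) e perm_prodr.
Qed.

End Annulus.

(** * Cardinalities of NC(n) and S_NC(p,q) *)

Lemma porbits_gamma n : porbits (gamma n.+1) = [set setT].
Proof.
apply/setP => B; rewrite inE; apply/imsetP/eqP => [[x _ ->]|->].
  by rewrite porbit_gamma.
by exists ord0; rewrite ?porbit_gamma.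
Qed.

Lemma card_NC n : 0 < n -> #|NC n| = catalan n.
Proof.
case: n => // n _; rewrite -sum1_card (eq_bigl _ _ (@NC_excess0 n)) card_excess0.
by rewrite /weight porbits_gamma big_set1 cardsT card_ord.
Qed.

Lemma weight_gamma n : weight (gamma n.+1) = catalan n.+1.
Proof. by rewrite -card_NC // -sum1_card (eq_bigl _ _ (@NC_excess0 n)) card_excess0. Qed.

Lemma porbits_gamma2 p q : porbits (gamma2 p.+1 q.+1) = [set left_part p.+1 q.+1;
  right_part p.+1 q.+1].
Proof.
rewrite porbits_prod !porbits_gamma !imset_set1; congr [set _; _]; apply/setP => x;
  apply/imsetP/imsetP => -[y _ ->]; by exists y.
Qed.

(** As [gamma2] has two cycles, the cycle count condition is [excess 2]; its weight cancels in
    [ncrossE]. *)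
Lemma card_SNC p q : 0 < p -> 0 < q -> #|SNC p q| = annular p q.
Proof.
case: p q => [|p] [|q] // _ _.
set X := left_part p.+1 q.+1; set Y := right_part p.+1 q.+1.
have pg := porbits_gamma2 p q; rewrite -/X -/Y in pg.
have oX : X \in porbits (gamma2 p.+1 q.+1) by rewrite pg !inE eqxx.
have oY : Y \in porbits (gamma2 p.+1 q.+1) by rewrite pg !inE eqxx orbT.
have nXY : X != Y.
  apply/eqP => /setP/(_ (lshift q.+1 ord0)); rewrite split_part.
  by rewrite -/Y; case: (_ \in Y).
have cX : #|X| = p.+1 by rewrite card_imset ?card_ord //; apply: lshift_inj.
have cY : #|Y| = q.+1 by rewrite card_imset ?card_ord //; apply: rshift_inj.
have := ncrossE (or_intror oX) oY nXY.
rewrite {1}/weight pg big_setU1 ?inE // big_set1 cX cY => /eqP.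
rewrite eqn_pmul2r ?muln_gt0 ?catalan_gt0 // => /eqP <-.
rewrite /ncross -sum1_card; apply: eq_bigl => u; rewrite inE andbC; congr (_ && _).
  by rewrite /excess /ncycles pg cards2 nXY card_ord.
apply/exists_inP/exists_inP => [[_ /imsetP[z _ ->] /andP[/existsP[i iz] /existsP[j jz]]]|[i
  iX iY]].
  (* A cycle through the first circle that never steps to the second one stays in the first. *)
  apply/exists_inP; apply: contraT => /exists_inPn no.
  have sub : porbit u (lshift q.+1 i) \subset X.
    by apply: porbit_sub => [|x xX]; [apply: imset_f|rewrite split_part no].
  have : rshift p.+1 j \in X.
    apply: (subsetP sub); move: iz jz; rewrite -!eq_porbit_mem => /eqP -> /eqP ->; exact: eqxx.
  by rewrite split_part imset_f.
exists (porbit u i); first exact: imset_f.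
case/imsetP: iX => i' _ e; case/imsetP: iY => j' _ e'.
apply/andP; split; apply/existsP; [exists i'|exists j']; rewrite -?e -?e' ?porbit_id //.
exact: mem_porbit1.
Qed.

Lemma porbits_eq (T : finType) (s : {perm T}) (B : {set T}) x : B \in porbits s ->
  x \in B -> B = porbit s x.
Proof. by case/imsetP => c _ ->; rewrite -eq_porbit_mem => /eqP ->. Qed.

(** * Elements of [PSNC'] as pairs of non-crossing permutations with a marked cycle each *)

Section Merge.
Variables p q : nat.
Implicit Types (u : 'S_p) (v : 'S_q) (c : {set 'I_p}) (d : {set 'I_q}).

Definition merge u v c d : {set {set 'I_(p + q)}} :=
  (lset q c :|: rset p d) |:
  (porbits (perm_prod u v) :\: [set lset q c; rset p d]).

Definition marked_pair := (('S_p * 'S_q) * ({set 'I_p} * {set 'I_q}))%type.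

Definition merge_pair (x : marked_pair) :=
  (merge x.1.1 x.1.2 x.2.1 x.2.2, perm_prod x.1.1 x.1.2).

Definition marked_pairs : {set marked_pair} :=
  [set x | [&& x.1.1 \in NC p, x.1.2 \in NC q,
    x.2.1 \in porbits x.1.1 & x.2.2 \in porbits x.1.2]].

Section One.
Variables (u : 'S_p) (v : 'S_q) (c : {set 'I_p}) (d : {set 'I_q}).
Hypotheses (cu : c \in porbits u) (dv : d \in porbits v).
Let pi := perm_prod u v.
Let L := lset q c.
Let D := rset p d.

Lemma lset_porbits : L \in porbits pi.
Proof. by rewrite porbits_prod inE imset_f. Qed.

Lemma rset_porbits : D \in porbits pi.
Proof. by rewrite porbits_prod inE orbC imset_f. Qed.

Lemma porbits_neq0 (T : finType) (s : {perm T}) B : B \in porbits s -> exists x, x \in B.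
Proof. by case/imsetP => x _ ->; exists x; apply: porbit_id. Qed.

Lemma lset_rset_notin : L :|: D \notin porbits pi.
Proof.
have [i ic] := porbits_neq0 cu; have [j jd] := porbits_neq0 dv.
apply/negP => o; have iU : lshift q i \in L :|: D by rewrite inE mem_lset ic.
have e := porbits_eq o iU; have iL : lshift q i \in L by rewrite mem_lset.
have := porbits_eq lset_porbits iL; rewrite -e => /setP/(_ (rshift p j)).
by rewrite inE mem_rset jd orbT lset_rshift.
Qed.

Lemma merge_partition : partition (merge u v c d) [set: 'I_(p + q)].
Proof.
have mem B : B \in merge u v c d -> B = L :|: D \/ [/\ B \in porbits pi, B != L & B != D].
  rewrite !inE => /orP[/eqP|/andP[]]; first by left.
  by rewrite negb_or => /andP[BL BD] o; right.
(* The block through x depends only on the cycle of x, so blocks sharing a point coincide. *)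
have one B x : B \in merge u v c d -> x \in B ->
    B = if (porbit pi x == L) || (porbit pi x == D) then L :|: D else porbit pi x.
  move=> /mem[->|[o BL BD]] xB.
    by case/setUP: xB => xB; rewrite -?(porbits_eq lset_porbits xB) -?(porbits_eq
      rset_porbits xB) eqxx ?orbT.
  by rewrite -(porbits_eq o xB) (negPf BL) (negPf BD).
apply/and3P; split.
- rewrite eqEsubset subsetT; apply/subsetP => x _; apply/bigcupP.
  have [/orP lr|/norP[nl nr]] := boolP ((porbit pi x == L) || (porbit pi x == D)).
    exists (L :|: D); first by rewrite inE inE eqxx.
    by rewrite inE; case: lr => /eqP <-; rewrite porbit_id ?orbT.
  exists (porbit pi x); last exact: porbit_id.
  by rewrite !inE (negPf nl) (negPf nr) imset_f // orbT.
- apply/trivIsetP => B B' BV BV'; apply: contraNT => /pred0Pn[x /= /andP[xB xB']].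
  by rewrite (one _ _ BV xB) (one _ _ BV' xB').
apply/negP => /mem[e|[o _ _]]; last by have [x] := porbits_neq0 o; rewrite inE.
have [i ic] := porbits_neq0 cu; move/setP: e => /(_ (lshift q i)).
by rewrite !inE mem_lset ic.
Qed.

Lemma merge_pair_PSNC' : u \in NC p -> v \in NC q -> (merge u v c d, pi) \in PSNC' p q.
Proof.
move=> uN vN; rewrite inE /=; apply/and3P; split.
- apply/andP; split => /=; first exact: merge_partition.
  apply/forall_inP => B o; apply/exists_inP.
  have [/orP lr|/norP[nl nr]] := boolP ((B == L) || (B == D)).
    exists (L :|: D); first by rewrite inE inE eqxx.
    by case: lr => /eqP ->; rewrite ?subsetUl ?subsetUr.
  by exists B; rewrite // !inE (negPf nl) (negPf nr) o orbT.
- by apply/imsetP; exists (u, v) => //; rewrite inE uN.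
apply/exists_inP; exists (L :|: D); first by rewrite inE inE eqxx.
apply/andP; split.
  apply/existsP; exists L; apply/existsP; exists D.
  rewrite lset_sub rset_sub !andbT; apply/eqP/setP => B; rewrite !inE.
  apply/andP/orP => [[o BU]|[]/eqP->]; last 2 first.
  - by rewrite lset_porbits subsetUl.
  - by rewrite rset_porbits subsetUr.
  have [x xB] := porbits_neq0 o; have := subsetP BU x xB; rewrite inE (porbits_eq o xB).
  by case/orP => xLD; [left|right]; apply/eqP/esym; apply: porbits_eq;
     rewrite ?lset_porbits ?rset_porbits.
apply/forall_inP => B; rewrite !inE => /orP[->//|/andP[_ o]]; apply/implyP => _.
suff -> : cycles_in pi B = [set B] by rewrite cards1.
apply/setP => B'; rewrite !inE; apply/andP/eqP => [[o' sub]|->]; last by rewrite o.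
have [x xB'] := porbits_neq0 o'.
by rewrite (porbits_eq o' xB') (porbits_eq o (subsetP sub x xB')).
Qed.

Lemma merge_exceptional B : B \in merge u v c d -> B \notin porbits pi -> B = L :|: D.
Proof. by rewrite !inE => /orP[/eqP//|/andP[_ ->]]. Qed.

End One.

(** The merged block is the only one that is not a cycle, and c and d are its traces on the two
    circles. *)
Lemma merge_pair_inj : {in marked_pairs &, injective merge_pair}.
Proof.
move=> [[u v] [c d]] [[u' v'] [c' d']]; rewrite !inE /= =>
  /and4P[_ _ cu dv] /and4P[_ _ cu' dv'].
case=> em /perm_prod_inj[eu ev]; rewrite -{}eu -{}ev in em cu' dv' *.
have : lset q c :|: rset p d \in merge u v c' d' by rewrite -em inE inE eqxx.
move/merge_exceptional => /(_ (lset_rset_notin cu dv)) e.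
have -> : c = c'.
  by apply/setP => i; move/setP: e => /(_ (lshift q i));
    rewrite !inE !mem_lset !rset_lshift !orbF.
have -> // : d = d'.
by apply/setP => i; move/setP: e => /(_ (rshift p i)); rewrite !inE !mem_rset !lset_rshift.
Qed.

Lemma cover_cycles (V : {set {set 'I_(p + q)}}) (pi : 'S_(p + q)) B x :
  is_partitioned_perm (V, pi) -> B \in V -> x \in B -> porbit pi x \in cycles_in pi B.
Proof.
case/andP=> /= /and3P[_ /trivIsetP tr _] /forall_inP sub BV xB.
rewrite inE imset_f //=; have /exists_inP[B' BV' s] :=
  sub _ (imset_f (porbit pi) (isT : x \in 'I_(p + q))).
have [<- //|ne] := eqVneq B' B.
have := tr _ _ BV' BV ne; rewrite -setI_eq0 => /eqP/setP/(_ x).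
by rewrite !inE xB (subsetP s) ?porbit_id.
Qed.

(** For surjectivity, c and d are the two cycles of the exceptional block, which they fill; any
    other block equals its only cycle. *)
Lemma PSNC'_merge : PSNC' p q = merge_pair @: marked_pairs.
Proof.
apply/setP => -[V pi]; apply/idP/imsetP => [|[[[u v] [c d]]]]; last first.
  by rewrite inE /= => /and4P[uN vN cu dv] ->; apply: merge_pair_PSNC'.
rewrite inE /= => /and3P[pp /imsetP[[u v]]]; rewrite inE /= => /andP[uN vN] epi.
case/exists_inP => B BV /andP[/existsP[c' /existsP[d' /and3P[/eqP cyc cl dr]]] /forall_inP
  oth].
have : c' \in cycles_in pi B by rewrite cyc !inE eqxx.
rewrite inE => /andP[oc cB].
have : d' \in cycles_in pi B by rewrite cyc !inE eqxx orbT.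
rewrite inE => /andP[od dB].
have [c cu ec] : exists2 c, c \in porbits u & c' = lset q c.
  move: oc; rewrite epi porbits_prod inE => /orP[] /imsetP[z zo e]; first by exists z.
  have [j jz] := porbits_neq0 zo; have := subsetP cl (rshift p j).
  by rewrite e mem_rset jz split_part imset_f // => /(_ isT).
have [d dv ed] : exists2 d, d \in porbits v & d' = rset p d.
  move: od; rewrite epi porbits_prod inE => /orP[] /imsetP[z zo e]; last by exists z.
  have [i iz] := porbits_neq0 zo; have := subsetP dr (lshift q i).
  rewrite e mem_lset iz => /(_ isT) ir.
  by have := split_part (lshift q i); rewrite ir imset_f.
have eB : B = c' :|: d'.
  apply/eqP; rewrite eqEsubset subUset cB dB !andbT; apply/subsetP => x xB.
  have := cover_cycles pp BV xB; rewrite cyc !inE => /orP[]/eqP <-; by rewrite porbit_id ?orbT.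
have single B' C : B' \in V -> B' != B -> C \in cycles_in pi B' -> B' = C.
  move=> BV' ne CB; have /cards1P[C' e] := implyP (oth _ BV') ne.
  move: (CB); rewrite e inE => /eqP ->; apply/eqP; rewrite eqEsubset; apply/andP; split.
    by apply/subsetP => x xB'; have := cover_cycles pp BV' xB'; rewrite e inE => /eqP <-;
      apply: porbit_id.
  have : C' \in cycles_in pi B' by rewrite e inE.
  by rewrite inE => /andP[].
have /and3P[_ /trivIsetP tr n0] := (andP pp).1.
have /forall_inP sub := (andP pp).2.
exists ((u, v), (c, d)); first by rewrite inE /= uN vN cu dv.
congr (_, _) => //; apply/setP => B'; rewrite /merge /= -epi -ec -ed !inE -eB.
have [->|ne] := eqVneq B' B; first by rewrite BV.
apply/idP/andP => [BV'|[/norP[nc nd] o]].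
  have [x xB'] : exists x, x \in B'.
    by apply/set0Pn; apply: contraNneq n0 => <-.
  have eC := single _ _ BV' ne (cover_cycles pp BV' xB').
  have oB' : B' \in porbits pi by rewrite eC imset_f.
  have dis : [disjoint B' & B] by apply: tr.
  split=> //; apply/norP; split; apply/eqP => e; move: dis; rewrite disjoint_sym;
    apply/negP/pred0Pn; exists x; rewrite /= xB' andbT.
    by apply: (subsetP cB); rewrite -e.
  by apply: (subsetP dB); rewrite -e.
have /exists_inP[B'' BV'' s] := sub _ o.
have inc : B' \in cycles_in pi B'' by rewrite inE o.
have [e|ne'] := eqVneq B'' B.
  by move: inc; rewrite e cyc !inE (negPf nc) (negPf nd).
by rewrite -(single _ _ BV'' ne' inc).
Qed.

End Merge.

(** * Cumulants of the square *)

Lemma sum_over_porbits (T : finType) (s : {perm T}) (w : nat -> nat) :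
  \sum_(c in porbits s) #|c| * w #|c| = \sum_x w #|porbit s x|.
Proof.
rewrite (partition_big (porbit s) (mem (porbits s))) /= => [|x _]; last exact: imset_f.
apply: eq_bigr => c co; rewrite -sum_nat_const; apply: eq_big => [x|x xc].
  by case/imsetP: co => y _ ->; rewrite eq_porbit_mem.
by rewrite (porbits_eq co xc).
Qed.

(** Counts pairs of a [u] and a point on a cycle of size m: by [sum_excess0_block] each of the n
    points lies on such a cycle for [ballot (n - m) m] elements of NC(n). *)
Lemma sum_NC_block n m : 0 < m <= n ->
  \sum_(u in NC n) \sum_(c in porbits u) (#|c| == m) = 'C(n.*2 - m.+1, n.-1).
Proof.
case: n m => [|n] [|m] // mn; apply/eqP; rewrite -(eqn_pmul2l (ltn0Sn m)); apply/eqP.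
rewrite -(ballot_block mn) big_distrr /=.
transitivity (\sum_(u in NC n.+1) \sum_x (#|porbit u x| == m.+1)).
  apply: eq_bigr => u _; rewrite -(sum_over_porbits u (fun k => k == m.+1)) big_distrr /=.
  by apply: eq_bigr => c _; case: eqP => [->|]; rewrite ?muln0.
rewrite exchange_big /= -[n.+1 in RHS]card_ord -sum_nat_const; apply: eq_bigr => x _.
apply/eqP; rewrite -(eqn_pmul2r (catalan_gt0 n.+1)); apply/eqP.
have := sum_excess0_block (gamma n.+1) x m.
rewrite porbit_gamma cardsT card_ord weight_gamma /block_path; case/andP: mn => _ -> <-.
by congr (_ * _); apply: eq_bigl => u; rewrite NC_excess0.
Qed.

Local Open Scope ring_scope.

Lemma sum_NC_blocks (C : nmodType) n (w : nat -> C) : (0 < n)%N ->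
  \sum_(u in NC n) \sum_(c in porbits u) w #|c| =
  \sum_(m < n) w m.+1 *+ 'C(n.*2 - m.+2, n.-1).
Proof.
move=> n0.
have wE u (c : {set 'I_n}) : c \in porbits u -> w #|c| = \sum_(m < n) w m.+1 *+ (#|c| == m.+1).
  move=> cu; have c0 : (0 < #|c|)%N by have [x xc] := porbits_neq0 cu; apply/card_gt0P;
    exists x.
  have lt : (#|c|.-1 < n)%N by rewrite prednK // -[X in (_ <= X)%N](card_ord n) max_card.
  rewrite (bigD1 (Ordinal lt)) //= prednK // eqxx big1 ?addr0 // => m ne.
  by case: eqP => // e; case/eqP: ne; apply: val_inj; rewrite /= e.
under eq_bigr => u _ do under eq_bigr => c cu do rewrite (wE u c cu).
under eq_bigr => u _ do rewrite exchange_big /=.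
rewrite exchange_big /=; apply: eq_bigr => m _.
rewrite -sum_NC_block ?ltn_ord // -sumrMnr; apply: eq_bigr => u _.
by rewrite -sumrMnr.
Qed.

Lemma sum_marked_pairs (C : nmodType) p q (w : nat -> nat -> C) : (0 < p)%N -> (0 < q)%N ->
  \sum_(x in marked_pairs p q) w #|x.2.1| #|x.2.2| =
  \sum_(m < p) \sum_(l < q) w m.+1 l.+1 *+ ('C(p.*2 - m.+2, p.-1) * 'C(q.*2 - l.+2, q.-1))%N.
Proof.
move=> p0 q0.
transitivity (\sum_(u in NC p) \sum_(c in porbits u) \sum_(v in NC q) \sum_(d in porbits v)
  w #|c| #|d|).
  symmetry; under eq_bigr => u _ do rewrite exchange_big /=.
  rewrite pair_big_dep /=.
  under eq_bigr => uv _ do rewrite pair_big_dep /=.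
  rewrite pair_big_dep /=; apply: eq_bigl => -[[u v] [c d]].
  by rewrite [in RHS]inE /= -!andbA.
under eq_bigr => u _ do under eq_bigr => c _ do rewrite (sum_NC_blocks (w #|c|)) //.
rewrite (sum_NC_blocks (fun m => \sum_(l < q) w m l.+1 *+ 'C(q.*2 - l.+2, q.-1))) //.
apply: eq_bigr => m _; rewrite -sumrMnl; apply: eq_bigr => l _.
by rewrite mulnC mulrnA.
Qed.

Section Cumulants.
Variables (A : pzRingType) (C : comPzRingType).
Variables (kappa : seq A -> C) (kappa2 : seq A -> seq A -> C) (a : A).

Lemma cycle_args_const n (f : 'I_n -> A) pi i : (forall i, f i = a) ->
  cycle_args f pi i = nseq #|porbit pi i| a.
Proof.
move=> fa; rewrite -size_orb /cycle_args; elim: (fingraph.orbit pi i) => //= x s ->.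
by rewrite fa.
Qed.

(** A cycle has exactly one leader, which decides the branch taken by [kappa_block]. *)
Lemma filter_leader n (u : 'S_n) c : c \in porbits u ->
  exists2 i, i \in c & [seq x <- enum 'I_n | (x \in c) && leader u x] = [:: i].
Proof.
move=> cu; have [x xc] := porbits_neq0 cu.
have [m lm em] := exists_leader u x; have ec := porbits_eq cu xc.
have mc : m \in c by rewrite ec -em porbit_id.
exists m => //; apply: perm_small_eq => //; apply: uniq_perm => // [|y].
  by rewrite filter_uniq ?enum_uniq.
rewrite mem_filter mem_enum andbT inE; apply/andP/eqP => [[yc ly]|->//].
by apply: (leader_uniq ly lm); rewrite em -(porbits_eq cu yc).
Qed.

Lemma filter_enum_set n (B : {set 'I_n}) (P : pred 'I_n) :
  [seq x <- enum B | P x] = [seq x <- enum 'I_n | (x \in B) && P x].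
Proof.
rewrite {1}[enum _](_ : _ = [seq x <- enum 'I_n | x \in B]).
  by rewrite -filter_predI; apply: eq_filter => x /=; rewrite andbC.
by rewrite [enum 'I_n]enumT.
Qed.

Hypothesis kappa1 : forall n, (0 < n)%N -> kappa (nseq n a) = 1.

Lemma kappa_block_porbit n (f : 'I_n -> A) pi B : (forall i, f i = a) -> B \in porbits pi ->
  kappa_block kappa kappa2 f pi B = 1.
Proof.
move=> fa o; rewrite /kappa_block filter_enum_set.
have [i iB ->] := filter_leader o.
by rewrite cycle_args_const // kappa1 // card_porbit_gt0.
Qed.

Lemma kappa_block_merge p q (f : 'I_(p + q) -> A) u v c d : (forall i, f i = a) ->
  c \in porbits u -> d \in porbits v ->
  kappa_block kappa kappa2 f (perm_prod u v) (lset q c :|: rset p d) =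
  kappa2 (nseq #|c| a) (nseq #|d| a).
Proof.
move=> fa cu dv; rewrite /kappa_block filter_enum_set enum_prod filter_cat.
rewrite (filter_map (lshift _)) (filter_map (@rshift _ _)).
rewrite (eq_filter (a2 := fun x => (x \in c) && leader u x)); last first.
  by move=> x /=; rewrite leader_prodl !inE mem_lset rset_lshift orbF.
rewrite [X in _ ++ map _ X](eq_filter (a2 := fun x => (x \in d) && leader v x)); last first.
  by move=> x /=; rewrite leader_prodr !inE mem_rset lset_rshift.
have [i ic ->] := filter_leader cu; have [j jd ->] := filter_leader dv.
rewrite /= !cycle_args_const // porbit_prodl porbit_prodr.
rewrite -(porbits_eq cu ic) -(porbits_eq dv jd).
by rewrite !card_imset //; [apply: rshift_inj|apply: lshift_inj].
Qed.

(** Blocks that are cycles contribute first order cumulants, all equal to 1; so an element of S_NC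
    contributes 1 and one of [PSNC'] the cumulant of its merged block. *)
Lemma sum_PSNC p q (f : 'I_(p + q) -> A) : (forall i, f i = a) ->
  \sum_(Vpi in PSNC p q) kappa_partitioned kappa kappa2 f Vpi =
  #|SNC p q|%:R + \sum_(x in marked_pairs p q) kappa2 (nseq #|x.2.1| a) (nseq #|x.2.2| a).
Proof.
move=> fa; pose S := [set (porbits pi, pi) | pi in SNC p q].
rewrite (eq_bigl [predU S & PSNC' p q]) => [|x]; last by rewrite in_setU.
rewrite bigU /=; last first.
  apply/pred0P => x /=; apply/negP => /andP[/imsetP[pi _ ->]].
  rewrite PSNC'_merge => /imsetP[[[u v] [c d]]]; rewrite inE /= => /and4P[_ _ cu dv] [e epi].
  by have := lset_rset_notin cu dv; rewrite -epi e inE inE eqxx.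
congr (_ + _).
  rewrite big_imset /= => [|s t _ _ [] //].
  rewrite -sumr_const; apply: eq_bigr => pi _.
  by rewrite /kappa_partitioned big1 // => B o; apply: kappa_block_porbit.
rewrite PSNC'_merge big_imset /=; last exact: merge_pair_inj.
apply: eq_bigr => -[[u v] [c d]]; rewrite inE /= => /and4P[uN vN cu dv].
rewrite /kappa_partitioned /merge big_setU1 /=; last first.
  by rewrite !inE (negPf (lset_rset_notin cu dv)) andbF.
rewrite kappa_block_merge // big1 ?mulr1 // => B; rewrite inE => /andP[_ o].
exact: kappa_block_porbit.
Qed.

End Cumulants.

(** * The claimed values and the fluctuation moments *)

Section Fluctuation.
Local Open Scope nat_scope.

Definition cumulant_value m l := \sum_(1 <= k < m.+1) k * 'C(m, k) * 'C(l, k).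

Lemma cumulant_value_widen m l M : m <= M ->
  cumulant_value m l = \sum_(k < M.+1) k * 'C(m, k) * 'C(l, k).
Proof.
move=> le; pose F k := k * 'C(m, k) * 'C(l, k).
transitivity (\sum_(k < m.+1) F k).
  by rewrite -(big_mkord xpredT) [RHS]big_ltn.
rewrite (big_ord_widen M.+1 F) ?ltnS // big_mkcond; apply: eq_bigr => k _.
by rewrite /F; case: ltnP => // lt; rewrite bin_small // muln0.
Qed.

(** For each k the sums over m and l factor, and [block_choose_sum] evaluates both. *)
Lemma sum_cumulant_value p q : 0 < p -> 0 < q ->
  \sum_(m < p) \sum_(l < q) cumulant_value m.+1 l.+1 *
     ('C(p.*2 - m.+2, p.-1) * 'C(q.*2 - l.+2, q.-1)) = annular p q.
Proof.
move=> p0 q0; pose M := p + q.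
rewrite (@annular_widen _ _ M.+1) ?ltnS ?leq_addl //.
have sh r k : 0 < r -> k != 0 -> \sum_(m < r) 'C(r.*2 - m.+2, r.-1) * 'C(m.+1, k) =
  'C(r.*2, r + k).
  case: k => // k r0 _; have := @block_choose_sum r k.+1 r0 isT.
  by rewrite big_ord_recl bin0n muln0.
transitivity (\sum_(m < p) \sum_(l < q) \sum_(k < M.+1) k *
   ('C(p.*2 - m.+2, p.-1) * 'C(m.+1, k)) * ('C(q.*2 - l.+2, q.-1) * 'C(l.+1, k))).
  apply: eq_bigr => m _; apply: eq_bigr => l _.
  rewrite (@cumulant_value_widen _ _ M) ?big_distrl /=; last by have := ltn_ord m; lia.
  by apply: eq_bigr => k _; lia.
under eq_bigr => m _ do rewrite exchange_big /=.
rewrite exchange_big /=; apply: eq_bigr => k _.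
have [->|k0] := eqVneq (k : nat) 0; first by rewrite !mul0n big1 // => m _; rewrite big1.
under eq_bigr => m _ do rewrite -big_distrr /= sh //.
by rewrite -big_distrl -big_distrr /= sh.
Qed.

Lemma sum_even n (F : nat -> nat) : (forall k, F k.*2.+1 = 0) ->
  \sum_(k < n.*2.+1) F k = \sum_(k < n.+1) F k.*2.
Proof.
move=> F0; elim: n => [|n IH]; first by rewrite !big_ord1.
by rewrite doubleS 2!big_ord_recr /= IH F0 addn0 [RHS]big_ord_recr.
Qed.

Lemma half_binom_even m k : half_binom m.*2 k.*2 = 'C(m.*2, m + k).
Proof.
rewrite /half_binom -doubleB odd_double doubleK andbT leq_double.
case: leqP => [le|lt]; last by rewrite bin_small //; lia.
rewrite -bin_sub; last lia.
by congr ('C(_, _)); lia.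
Qed.

Lemma half_binom_odd m k : half_binom m.*2 k.*2.+1 = 0.
Proof. by rewrite /half_binom; case: leqP => //= le; rewrite oddB //= !odd_double. Qed.

(** Only even indices contribute, and the leading factor k, being even, yields the 2. *)
Lemma fluctuation_sum p q :
  \sum_(1 <= k < p.*2.+1) k * half_binom p.*2 k * half_binom q.*2 k = 2 * annular p q.
Proof.
pose F k := k * half_binom p.*2 k * half_binom q.*2 k.
transitivity (\sum_(k < p.*2.+1) F k).
  by rewrite -(big_mkord xpredT) [RHS]big_ltn // /F mul0n.
rewrite (@sum_even p F) => [|k]; last by rewrite /F half_binom_odd muln0.
rewrite (@annular_widen _ _ (p + q).+1) ?ltnS ?leq_addl // big_distrr /=.
rewrite (big_ord_widen (p + q).+1 (fun k => F k.*2)) ?ltnS ?leq_addr // big_mkcond /=.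
apply: eq_bigr => k _; rewrite /F !half_binom_even; case: ltnP => [_|lt]; first lia.
by rewrite bin_small ?muln0 //; lia.
Qed.

End Fluctuation.

(** * Cumulants of x^2 by induction on the number of arguments *)

Section Main.
Variable R : realType.
Local Notation C := R[i].
Variable kappa : seq {poly C} -> C.
Variable kappa2 : seq {poly C} -> seq {poly C} -> C.
Hypothesis hkappa : free_cumulants (@sc_phi R) kappa.
Hypothesis hkappa2 : second_order_cumulants (@sc_phi2 R) kappa kappa2.
Let a : {poly C} := 'X^2.

Lemma prod_nseq n : \prod_(x <- nseq n a) x = 'X^(n.*2).
Proof. by rewrite big_nseq iter_mulr_1 /a -exprM mul2n. Qed.

Lemma sc_moment_even n : sc_moment R n.*2 = (catalan n)%:R.
Proof.
rewrite /sc_moment odd_double doubleK -catalan_bin natrM mulfK //.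
by rewrite Num.Theory.pnatr_eq0.
Qed.

Lemma sc_fluctuation_even p q : (0 < p)%N -> (0 < q)%N ->
  sc_fluctuation R p.*2 q.*2 = (2 * annular p q)%N%:R.
Proof.
move=> p0 q0; rewrite /sc_fluctuation !double_eq0 !eqn0Ngt p0 q0 oddD !odd_double /=.
by rewrite fluctuation_sum.
Qed.

Lemma nth_nseq_const n i : (i < n)%N -> nth 0 (nseq n a) i = a.
Proof. by move=> lt; rewrite nth_nseq lt. Qed.

Lemma kappa_square n : (0 < n)%N -> kappa (nseq n a) = 1.
Proof.
elim/ltn_ind: n => n IH n0.
have e : sc_phi (\prod_(x <- nseq n a) x) =
    \sum_(pi in NC n) kappa_perm kappa (fun i : 'I_n => nth 0 (nseq n a) i) pi.
  have := hkappa (s := nseq n a); rewrite size_nseq => H; exact: H.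
move: e; rewrite prod_nseq sc_phiXn sc_moment_even.
rewrite (bigD1 (gamma n)) /=; last by case: n n0 {IH} => // n _; apply: gamma_NC.
rewrite kappa_perm_gamma ?size_nseq //.
(* All other elements of NC(n) have cycles shorter than n, so their terms are 1; as the moment is
   |NC(n)|, the term of [gamma n] is 1 too. *)
rewrite (eq_bigr (fun _ => 1)) => [|pi /andP[piN ne]]; last first.
  rewrite /kappa_perm big1 // => i _.
  have := size_cycle_NC (nth 0 (nseq n a)) i piN ne; rewrite size_cycle_args.
  rewrite (@cycle_args_const _ a) => [lt|j]; last by rewrite nth_nseq_const.
  by apply: IH; rewrite ?card_porbit_gt0.
have gN : gamma n \in NC n by case: n n0 {IH} => // n _; apply: gamma_NC.
rewrite -card_NC // -sum1_card natr_sum (bigD1 (gamma n)) //=.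
by move/addIr => <-.
Qed.

Lemma kappa2_square p q : (0 < p)%N -> (0 < q)%N ->
  kappa2 (nseq p a) (nseq q a) = (cumulant_value p q)%:R.
Proof.
have [n le] := ubnP (p + q); elim: n p q le => // n IH p q le p0 q0.
have H : sc_phi2 (\prod_(x <- nseq p a) x) (\prod_(x <- nseq q a) x) =
    \sum_(Vpi in PSNC p q)
      kappa_partitioned kappa kappa2 (fun i : 'I_(p + q) =>
        nth 0 (nseq p a ++ nseq q a) i) Vpi.
  have := hkappa2 (s := nseq p a) (t := nseq q a); rewrite !size_nseq; exact.
move: H; rewrite !prod_nseq sc_phi2Xn sc_fluctuation_even // (@sum_PSNC _ _ _ _ a) //;
  last 2 first.
- exact: kappa_square.
- by move=> i; rewrite -nseqD nth_nseq_const.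
(* Half of the moment cancels against |S_NC(p,q)|; the other half is expanded by
   [sum_cumulant_value], with the coefficients of the sum over marked pairs. *)
rewrite card_SNC // mul2n -addnn natrD => /addrI.
rewrite (sum_marked_pairs (fun m l => kappa2 (nseq m a) (nseq l a))) //.
rewrite -{1}(sum_cumulant_value p0 q0) natr_sum.
case: p q p0 q0 le => [|p] // [|q] // _ _ le.
under eq_bigr => m _ do rewrite natr_sum.
rewrite !pair_big /= (bigD1 (ord_max, ord_max)) //= [RHS](bigD1 (ord_max, ord_max)) //=.
(* The largest pair of block sizes has coefficient 1. The other pairs agree by induction, so the top
   terms agree. *)
have top r : 'C(r.+1.*2 - r.+2, r) = 1%N.
  by have -> : (r.+1.*2 - r.+2 = r)%N; [lia|exact: binn].
rewrite !top !muln1 mulr1n => e; symmetry; move: e.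
rewrite [X in _ + X = _](eq_bigr (fun ml : 'I_p.+1 * 'I_q.+1 =>
  kappa2 (nseq ml.1.+1 a) (nseq ml.2.+1 a) *+
  ('C(p.+1.*2 - ml.1.+2, p) * 'C(q.+1.*2 - ml.2.+2, q)))%N); first exact: addIr.
move=> -[m l] ne; rewrite natrM IH // ?mulr_natr //.
rewrite -ltnS (leq_trans _ le) // ltnS; move: (ltn_ord m) (ltn_ord l) ne.
rewrite xpair_eqE -!val_eqE /=; lia.
Qed.

End Main.

Unset Implicit Arguments.

(* The sum over k >= 1 stops at p, as 'C(p, k) = 0 for k > p. *)
Theorem proposition30 (R : realType)
    (kappa : seq {poly R[i]} -> R[i])
    (kappa2 : seq {poly R[i]} -> seq {poly R[i]} -> R[i])
    (hkappa : free_cumulants (@sc_phi R) kappa)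
    (hkappa2 : second_order_cumulants (@sc_phi2 R) kappa kappa2)
    (p q : nat) (hp : (1 <= p)%N) (hq : (1 <= q)%N) :
  let a : {poly R[i]} := 'X^2 in
  kappa2 (nseq p a) (nseq q a) =
    (\sum_(1 <= k < p.+1) k * 'C(p, k) * 'C(q, k))%N%:R.
Proof. exact: (kappa2_square hkappa hkappa2 hp hq). Qed.
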